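(* Let $d\ge 2$. If $P$ is any boundedly finite supersaturable property (of measurable subsets of $\mathbb{R}^d$) and $\Omega\subset\mathbb{R}^d$ is a measurable set, then there is a locally optimal set for $P$ with respect to $\Omega$.
   Context: Let $\mathfrak{M}(\mathbb{R}^d)$ be the family of Lebesgue measurable subsets of $\mathbb{R}^d$, $|\cdot|$ Lebesgue measure, $Q(x,r)$ the open axis-parallel cube of side length $r$ centered at $x$. A property is a function $P\colon\mathfrak{M}(\mathbb{R}^d)\to\{0,1\}$; $A$ has $P$ if $P(A)=1$. Put $\bar d(A)=\limsup_{R\to\infty}|A\cap Q(0,R)|/|Q(0,R)|$, $m(P)=\sup_{P(A)=1}\bar d(A)$, and $\mathcal{Z}_\delta(\varepsilon)A=\{x\in\mathbb{R}^d : |Q(x,\delta)\cap A|>\varepsilon|Q(x,\delta)|\}$ for $\delta,\varepsilon>0$. Supersaturable: $P$ is supersaturable if there is a function $I_P\colon\mathfrak{M}(\mathbb{R}^d)\to[0,\infty]$ (a saturation function for $P$) such that: (I) $0<m(P)$. (II) If $A\supset B$ then $I_P(A)\ge I_P(B)$ and $P(A)\le P(B)$. (III) $I_P(A)>0$ implies that $A$ does not have $P$. (IV) $P(A)=P(A+x)$ and $I_P(A)=I_P(A+x)$ for every $x\in\mathbb{R}^d$. (V) There is a real number $\operatorname{diam}(P)$ such that if $A_1,A_2$ are at distance at least $\operatorname{diam}(P)$ from each other, then $I_P(A_1\cup A_2)\ge I_P(A_1)+I_P(A_2)$, and $A_1\cup A_2$ has $P$ iff both $A_1$ and $A_2$ have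 $P$. (VI) There are $\varepsilon>0$ (with $1-\varepsilon>0$) and a strictly positive function $f$ such that if $\mathcal{Z}_\delta(1-\varepsilon)A$ does not have $P$, then $I_P(A)\ge f(\delta)$. (VII) If $A\subset Q(0,R)$ then $I_P(A)\ge g_P(\varepsilon)I_P(\mathcal{Z}_\delta(\varepsilon)A)-h_P(\varepsilon,\delta)R^d$, where $g_P$ is positive and $h_P(\varepsilon,\delta)\to0$ as $\delta\to0$ for any fixed $\varepsilon>0$. Boundedly finite: $P$ is finite if there is a family $\mathcal{P}$ of finite sets such that $A$ has $P$ iff no set in $\mathcal{P}$ is a subset of $A$; it is boundedly finite if in addition the diameters of the sets in $\mathcal{P}$ are bounded. Locally optimal: a measurable set $A\subset\Omega$ having property $P$ is locally optimal for $P$ with respect to $\Omega$ if for every bounded measurable set $S$ there is no measurable $A'\subset\Omega$ with property $P$ such that $A\cap(\mathbb{R}^d\setminus S)=A'\cap(\mathbb{R}^d\setminus S)$ and $|A'\cap S|>|A\cap S|$. *)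

(* Defs.v *)
From HB Require Import structures.
From mathcomp Require Import all_boot all_order all_algebra.
From mathcomp Require Import all_classical all_reals all_analysis.

Set Implicit Arguments.
Unset Strict Implicit.
Unset Printing Implicit Defensive.
Import Order.TTheory GRing.Theory Num.Theory.
Import numFieldNormedType.Exports.

Local Open Scope classical_set_scope.
Local Open Scope ring_scope.

Section EuclideanSpace.
Context {R : realType} {d : nat}.
Implicit Types (x y a b : 'rV[R]_d) (A B F S : set 'rV[R]_d).

Definition euclidean_dist x y : R :=
  Num.sqrt (\sum_(i < d) (x 0 i - y 0 i) ^+ 2).

Definition box a b : set 'rV[R]_d :=
  [set x | forall i, a 0 i < x 0 i <= b 0 i].

Definition box_volume a b : R := \prod_(i < d) (b 0 i - a 0 i).

Definition box_cover A (a b : nat -> 'rV[R]_d) : Prop :=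
  (forall k i, a k 0 i <= b k 0 i) /\ A `<=` \bigcup_k box (a k) (b k).

(* Lebesgue outer measure, meaningful for [0 < d]: for [d = 0] the only box is
   the whole space, of volume 1, so that even the empty set gets [+oo]. *)
Definition lebesgue_outer A : \bar R :=
  ereal_inf [set v | exists a b : nat -> 'rV[R]_d, box_cover A a b /\
                     v = (\sum_(k <oo) (box_volume (a k) (b k))%:E)%E].

Definition lebesgue_measurable A : Prop :=
  lebesgue_outer.-caratheodory A.

Definition cube x (r : R) : set 'rV[R]_d :=
  [set y | forall i, `|y 0 i - x 0 i| < r / 2].

Definition translate A x : set 'rV[R]_d := [set y + x | y in A].

Definition upper_density A : \bar R :=
  limf_esup (fun r : R =>
    (lebesgue_outer (A `&` cube 0%R r) / lebesgue_outer (cube 0%R r))%E)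
    (pinfty_nbhs R).

(* Z_delta(eps) A *)
Definition zooming_out (delta eps : R) A : set 'rV[R]_d :=
  [set x | (eps%:E * lebesgue_outer (cube x delta)
            < lebesgue_outer (cube x delta `&` A))%E].

(* Distance at least [D]; holds vacuously when a set is empty
   (infimum over the empty set is infinite). *)
Definition apart (D : R) A B : Prop :=
  forall x y, A x -> B y -> D <= euclidean_dist x y.

End EuclideanSpace.

(* A property, and likewise a saturation function, is a function on the
   Lebesgue measurable sets. Both are represented by functions on all sets, and
   every condition below constrains, or refers to, their values at measurable
   sets only. *)
Section Properties.
Context {R : realType} {d : nat}.
Implicit Types (P : set 'rV[R]_d -> bool) (I : set 'rV[R]_d -> \bar R).

Definition max_density P : \bar R :=
  ereal_sup [set upper_density A | A in
    [set A : set 'rV[R]_d | lebesgue_measurable A /\ P A]].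

Record saturation_function P I : Prop := SaturationFunction {
  sat_ge0 : forall A, lebesgue_measurable A -> (0 <= I A)%E ;
  sat_density : (0 < max_density P)%E ;
  sat_monotone : forall A B, lebesgue_measurable A -> lebesgue_measurable B ->
    B `<=` A -> (I B <= I A)%E /\ (P A -> P B) ;
  sat_positive : forall A, lebesgue_measurable A -> (0 < I A)%E -> ~~ P A ;
  sat_translate : forall A x, lebesgue_measurable A ->
    P A = P (translate A x) /\ I A = I (translate A x) ;
  sat_separated : exists diam : R, forall A1 A2,
    lebesgue_measurable A1 -> lebesgue_measurable A2 ->
    apart diam A1 A2 ->
    (I A1 + I A2 <= I (A1 `|` A2))%E /\ (P (A1 `|` A2) <-> P A1 /\ P A2) ;
  sat_supersaturation : exists (eps : R) (f : R -> R),
    [/\ 0 < eps, 0 < 1 - eps,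
        (forall delta : R, 0 < delta -> 0 < f delta) &
        forall (delta : R) A, 0 < delta -> lebesgue_measurable A ->
          ~~ P (zooming_out delta (1 - eps) A) -> ((f delta)%:E <= I A)%E] ;
  sat_zooming : exists (g : R -> R) (h : R -> R -> R),
    [/\ (forall eps : R, 0 < eps -> 0 < g eps),
        (forall eps : R, 0 < eps -> h eps delta @[delta --> 0^'+] --> (0 : R)) &
        forall (eps delta r : R) A, 0 < eps -> 0 < delta -> 0 < r ->
          lebesgue_measurable A -> A `<=` cube 0 r ->
          ((g eps)%:E * I (zooming_out delta eps A) - (h eps delta * r ^+ d)%:E
           <= I A)%E] }.

Definition supersaturable P : Prop := exists I, saturation_function P I.

Definition boundedly_finite P : Prop :=
  exists FF : set (set 'rV[R]_d),
    [/\ (forall F, FF F -> finite_set F),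
        (forall A, lebesgue_measurable A ->
           (P A <-> ~ exists2 F, FF F & F `<=` A)) &
        exists D : R, forall F, FF F ->
          forall x y, F x -> F y -> euclidean_dist x y <= D].

Definition locally_optimal P (Omega A : set 'rV[R]_d) : Prop :=
  [/\ lebesgue_measurable A, A `<=` Omega, P A &
      forall S : set 'rV[R]_d, bounded_set S -> lebesgue_measurable S ->
        ~ exists A' : set 'rV[R]_d,
            [/\ lebesgue_measurable A', A' `<=` Omega, P A',
                A `&` ~` S = A' `&` ~` S &
                (lebesgue_outer (A `&` S) < lebesgue_outer (A' `&` S))%E]].

End Properties.

(* Main.v *)
Require Import Defs.
From HB Require Import structures.
From mathcomp Require Import all_boot all_order all_algebra.
From mathcomp Require Import all_classical all_reals all_analysis.
From mathcomp Require Import ring lra zify.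
Set Implicit Arguments.
Unset Strict Implicit.
Unset Printing Implicit Defensive.
Import Order.TTheory GRing.Theory Num.Theory.
Import numFieldNormedType.Exports.
Local Open Scope classical_set_scope.
Local Open Scope ring_scope.

(** The locally optimal set is a limit of almost optimal sets in growing
windows; the point is that the property [P] survives the passage to the limit.

Let [B j] be a subset of [Omega] inside the window (-j, j]^d that has [P] and
whose measure is within 1/(j+1) of the supremum ([near_optimal]), and fix a
nonprincipal ultrafilter on the indices [j]. A dyadic cube is called dense at
threshold [c] when, for ultrafilter-many [j], the set [B j] fills more than the
proportion [c] of it. The set [core c] consists of the points all of whose
dyadic cubes are dense at threshold [c]; it grows as [c] decreases. The union
of the cores plays the role of the set where a weak limit of the indicators of
the [B j] is positive.

No mass is lost outside this union ([core_mass]). Descending the dyadic grid,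
the first sparse cubes that one meets are disjoint, and [B j] fills at most the
proportion [c] of each; so [B j] has measure at most about [c] times that of
the window outside [core c].

Let [D] be the set of the points that, for some [m], lie in the core of
threshold 2^-m and see it with density more than [1 - e] at all sufficiently
late terms of a sparse sequence of scales. [D] is almost all of the union of the
cores ([density_small], [exists_scales]). The complement of a core is an
increasing union of unions of dyadic cubes, which reduces the density statement
to a covering argument at a single scale followed by the Borel-Cantelli lemma.

[D] has [P] ([core_points_property]). Otherwise it contains a finite forbidden
set [S], and [S] lies in Z_delta(1 - e) of one core of threshold [c], for one
scale [delta]. In a window around [S], that core lies in Z_s(c / 3^d)(B j) for
every dyadic [s] and ultrafilter-many [j]. The supersaturation condition then bounds the
saturation of Z_s(c / 3^d)(B j) below by f(delta). Since [c] and [delta] stay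
fixed while [s] tends to 0, the zooming inequality gives positive
saturation to [B j] in the window, although [B j] has [P]. It is in order to
keep [c] fixed that a core asks for density at all scales.

Finally [D `&` Omega] is locally optimal ([locally_optimal_limit]). Suppose
that [A'] improves it on a bounded set [S]. Inside a window that contains [S]
with a margin, [B j] has almost no mass outside [D]; delete that mass, and
replace [B j] by [A'] on [S]. A forbidden set is too small to reach from [S]
to the outside of the window, so the new set has [P], and it beats [B j] by more
than 1/(j+1) for suitable [j]. *)

(** * The Lebesgue outer measure *)
Section OuterMeasure.
Context {R : realType} {n : nat}.
Implicit Types (A B X : set 'rV[R]_n.+1) (a b : 'rV[R]_n.+1).
Local Notation lam := (@lebesgue_outer R n.+1).

Lemma box_volume_ge0 a b : (forall i, a 0 i <= b 0 i) -> 0 <= box_volume a b.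
Proof. by move=> ab; apply: prodr_ge0 => i _; rewrite subr_ge0. Qed.

Lemma lebesgue_outer_ge0 A : (0 <= lam A)%E.
Proof.
apply: le_ereal_inf_tmp => _ [a [b [[ab _] ->]]].
by apply: nneseries_ge0 => k _ _; rewrite lee_fin box_volume_ge0.
Qed.

Lemma le_lebesgue_outer : {homo lam : A B / A `<=` B >-> (A <= B)%E}.
Proof.
move=> A B AB; apply/ereal_inf_le_tmp => _ [a [b [[ab Bab] ->]]].
by exists a, b; split=> //; split=> //; exact: subset_trans AB Bab.
Qed.

Lemma lebesgue_outer_cover A (a b : nat -> 'rV[R]_n.+1) : box_cover A a b ->
  (lam A <= \sum_(k <oo) (box_volume (a k) (b k))%:E)%E.
Proof. by move=> cA; apply: ereal_inf_lbound; exists a, b. Qed.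

Lemma lebesgue_outer0 : lam set0 = 0%E.
Proof.
apply/eqP; rewrite eq_le lebesgue_outer_ge0 andbT.
apply: le_trans (lebesgue_outer_cover (a := fun=> 0) (b := fun=> 0) _) _.
  by split=> [k i|x []].
by rewrite eseries0 // => k _ _; rewrite /box_volume big_ord_recl subrr mul0r.
Qed.

Lemma lebesgue_outer_approx A (e : R) : (lam A < +oo)%E -> 0 < e ->
  exists ab : nat -> 'rV[R]_n.+1 * 'rV[R]_n.+1,
    box_cover A (fun k => (ab k).1) (fun k => (ab k).2) /\
    (\sum_(k <oo) (box_volume (ab k).1 (ab k).2)%:E <= lam A + e%:E)%E.
Proof.
move=> Afin e0; have Afn : lam A \is a fin_num.
  by rewrite ge0_fin_numE ?lebesgue_outer_ge0.
have [_ [a [b [cA ->]]] /ltW lt_e] := lb_ereal_inf_adherent e0 Afn.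
by exists (fun k => (a k, b k)); split.
Qed.

Lemma lebesgue_outer_sigma_subadditive : sigma_subadditive lam.
Proof.
move=> A; have [[i ioo]|/forallNP Aoo] := pselect (exists i, lam (A i) = +oo%E).
  by rewrite (eseries_pinfty _ _ ioo) ?leey// => k _;
    rewrite -ltNye (lt_le_trans _ (lebesgue_outer_ge0 _)).
apply/lee_addgt0Pr => e e0.
apply: le_trans (epsilon_trick _ _ (ltW e0)); last first.
  by move=> k; exact: lebesgue_outer_ge0.
have /choice [ab abP] : forall i, exists ab : nat -> 'rV[R]_n.+1 * 'rV[R]_n.+1,
    box_cover (A i) (fun k => (ab k).1) (fun k => (ab k).2) /\
    (\sum_(k <oo) (box_volume (ab k).1 (ab k).2)%:E
      <= lam (A i) + (e / (2 ^ i.+1)%:R)%:E)%E.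
  move=> i; apply: lebesgue_outer_approx; first by rewrite ltey; apply/eqP; exact: Aoo.
  by rewrite divr_gt0 // ltr0n expn_gt0.
have vol0 i k : (0 <= (box_volume (ab i k).1 (ab i k).2)%:E)%E.
  by rewrite lee_fin; apply: box_volume_ge0; exact: (abP i).1.1.
(* One cover of the union: the covers of all the [A i], enumerated by [nat]
   through a bijection with the pairs. *)
have /card_esym/ppcard_eqP[f] := card_nat2.
pose v (p : nat * nat) := (box_volume (ab p.1 p.2).1 (ab p.1 p.2).2)%:E.
apply: (@le_trans _ _ (\esum_(p in setT) v p)).
  rewrite (@reindex_esum _ _ _ setT setT f) //.
  rewrite -nneseries_esumT; last by move=> k; exact: vol0.
  apply: (@lebesgue_outer_cover _ (fun k => (ab (f k).1 (f k).2).1)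
    (fun k => (ab (f k).1 (f k).2).2)).
  split=> [k i|x [i _ /(abP i).1.2 [j _ xij]]]; first exact: (abP _).1.1.
  by exists (f^-1%FUN (i, j)) => //=; rewrite invK ?inE.
rewrite (_ : \esum_(p in setT) v p = \sum_(i <oo) \sum_(j <oo) v (i, j))%E.
  apply: lee_nneseries => [i _ _|i _]; last exact: (abP i).2.
  by apply: nneseries_ge0 => j _ _; exact: vol0.
have -> : setT = setT `*`` (fun=> setT) :> set (nat * nat) by apply/seteqP; split.
rewrite -(@esum_esum _ _ _ setT (fun=> setT) (fun i j => v (i, j))); last first.
  by move=> *; exact: vol0.
rewrite nneseries_esumT; last by move=> i; apply: nneseries_ge0 => j _ _; exact: vol0.
by apply: eq_esum => i _; rewrite nneseries_esumT // => j; exact: vol0.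
Qed.

HB.instance Definition _ := isOuterMeasure.Build R 'rV[R]_n.+1 lam
  lebesgue_outer0 lebesgue_outer_ge0 le_lebesgue_outer
  lebesgue_outer_sigma_subadditive.

Lemma lebesgue_outer_box a b : (forall i, a 0 i <= b 0 i) ->
  (lam (box a b) <= (box_volume a b)%:E)%E.
Proof.
move=> ab.
apply: le_trans (lebesgue_outer_cover (a := fun k => if k is 0 then a else 0)
  (b := fun k => if k is 0 then b else 0) _) _.
  by split=> [[|k] i //|x xab]; exists 0.
rewrite nneseries_recl //; last first.
  by move=> [|k] _; rewrite lee_fin box_volume_ge0.
rewrite eseries_cond eseries0 ?adde0// => -[|]//= k _ _.
by rewrite /box_volume big_ord_recl subrr mul0r.
Qed.

End OuterMeasure.

(** * Measurable sets and translations *)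
Section MeasurableSets.
Context {R : realType} {n : nat}.
Implicit Types (A B X : set 'rV[R]_n.+1) (a b x y : 'rV[R]_n.+1).
Local Notation lam := (@lebesgue_outer R n.+1).
Local Notation T := (caratheodory_type lam).

(** The detour through [mu] lets unification find the bundled outer measure on
which the measure structure of [caratheodory_type] depends. *)
Definition lebesgue : {measure set T -> \bar R} :=
  let mu : {outer_measure set 'rV[R]_n.+1 -> \bar R} := lam in
  (mu : set (caratheodory_type mu) -> \bar R).

Lemma lebesgueE A : lebesgue A = lam A. Proof. by []. Qed.

Lemma lebesgue_outerU A B : (lam (A `|` B) <= lam A + lam B)%E.
Proof. exact: outer_measureU2. Qed.

Lemma lebesgue_outer_bigU (I : finType) (F : I -> set 'rV[R]_n.+1) :
  (lam [set x | exists i, F i x] <= \sum_i lam (F i))%E.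
Proof.
rewrite (_ : [set x | _] = [set x | exists2 i, i \in index_enum I & F i x]).
  elim: (index_enum I) => [|i r IHr].
    rewrite big_nil (_ : [set x | _] = set0) ?lebesgue_outer0 //.
    by apply/seteqP; split=> // x [].
  rewrite big_cons; apply: le_trans (leeD (lexx _) IHr).
  apply: le_trans (lebesgue_outerU _ _); apply: le_lebesgue_outer => x [j].
  by rewrite inE => /predU1P[->|jr] Fx; [left|right; exists j].
apply/seteqP; split=> x /= [i]; last by exists i.
by exists i => //; rewrite mem_index_enum.
Qed.

Lemma lmeasurable0 : lebesgue_measurable (set0 : set 'rV[R]_n.+1).
Proof. exact: (@measurable0 _ T). Qed.

Lemma lmeasurableC A : lebesgue_measurable A -> lebesgue_measurable (~` A).
Proof. exact: (@measurableC _ T). Qed.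

Lemma lmeasurableT : lebesgue_measurable (setT : set 'rV[R]_n.+1).
Proof. exact: (@measurableT _ T). Qed.

Lemma lmeasurableU A B : lebesgue_measurable A -> lebesgue_measurable B ->
  lebesgue_measurable (A `|` B).
Proof. exact: (@measurableU _ T). Qed.

Lemma lmeasurableI A B : lebesgue_measurable A -> lebesgue_measurable B ->
  lebesgue_measurable (A `&` B).
Proof. exact: (@measurableI _ T). Qed.

Lemma lmeasurableD A B : lebesgue_measurable A -> lebesgue_measurable B ->
  lebesgue_measurable (A `\` B).
Proof. exact: (@measurableD _ T). Qed.

Lemma lmeasurable_bigcup (F : nat -> set 'rV[R]_n.+1) :
  (forall k, lebesgue_measurable (F k)) -> lebesgue_measurable (\bigcup_k F k).
Proof. by move=> mF; apply: (@bigcup_measurable _ T) => k _; exact: mF. Qed.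

Lemma lmeasurable_bigcap (F : nat -> set 'rV[R]_n.+1) :
  (forall k, lebesgue_measurable (F k)) -> lebesgue_measurable (\bigcap_k F k).
Proof.
by move=> mF; apply: (@bigcap_measurableType _ T) => k _; exact: mF.
Qed.

Lemma lmeasurable_forall (I : finType) (F : I -> set 'rV[R]_n.+1) :
  (forall i, lebesgue_measurable (F i)) ->
  lebesgue_measurable [set x | forall i, F i x].
Proof.
move=> mF; rewrite (_ : [set x | _] = \bigcap_i F i).
  by apply: (@fin_bigcap_measurable _ T) => // i _; exact: mF.
by apply/seteqP; split=> x /= Fx i => [_|]; exact: Fx.
Qed.

Let cut a i t : 'rV[R]_n.+1 := \row_j if j == i then t else a 0 j.

Let box_volume_cut a b i t :
  box_volume a (cut b i t) + box_volume (cut a i t) b = box_volume a b.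
Proof.
rewrite /box_volume (bigD1 i) //= [X in _ + X](bigD1 i) //= [RHS](bigD1 i) //=.
rewrite !mxE eqxx.
have eq_l : \prod_(j < n.+1 | j != i) (cut b i t 0 j - a 0 j) =
            \prod_(j < n.+1 | j != i) (b 0 j - a 0 j).
  by apply: eq_bigr => j /negbTE ji; rewrite mxE ji.
have eq_r : \prod_(j < n.+1 | j != i) (b 0 j - cut a i t 0 j) =
            \prod_(j < n.+1 | j != i) (b 0 j - a 0 j).
  by apply: eq_bigr => j /negbTE ji; rewrite mxE ji.
by rewrite eq_l eq_r -mulrDl; congr (_ * _); ring.
Qed.

(** A hyperplane [x_i = c] cuts each box of a cover into two boxes whose volumes
add up, so an almost optimal cover of [X] splits into covers of the two parts of
[X] without extra cost. *)
Lemma lmeasurable_halfspace i (c : R) :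
  lebesgue_measurable [set x : 'rV[R]_n.+1 | x 0 i <= c].
Proof.
apply: le_caratheodory_measurable => X; set H := [set x | _].
suff : (lam (X `&` H) + lam (X `&` ~` H) <= lam X)%E by [].
have [->|Xfin] := eqVneq (lam X) +oo%E; first exact: leey.
apply/lee_addgt0Pr => e e0.
have {}Xfin : (lam X < +oo)%E by rewrite ltey.
have [ab [[ab_le cX] abX]] := lebesgue_outer_approx Xfin e0.
apply: le_trans abX.
(* [t k] is [c] clamped to the [i]-th side of the [k]-th box: a box on one side
   of the hyperplane is cut into itself and a degenerate box. *)
pose t k := Num.min ((ab k).2 0 i) (Num.max ((ab k).1 0 i) c).
have t_ge k : (ab k).1 0 i <= t k by rewrite le_min ab_le le_max lexx.
have t_le k : t k <= (ab k).2 0 i by rewrite ge_min lexx.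
pose a' k := cut (ab k).1 i (t k); pose b' k := cut (ab k).2 i (t k).
have ab' k j : (ab k).1 0 j <= b' k 0 j.
  by rewrite mxE; case: eqP => [->|_]; [exact: t_ge|exact: ab_le].
have a'b k j : a' k 0 j <= (ab k).2 0 j.
  by rewrite mxE; case: eqP => [->|_]; [exact: t_le|exact: ab_le].
have -> : (\sum_(k <oo) (box_volume (ab k).1 (ab k).2)%:E =
    \sum_(k <oo) (box_volume (ab k).1 (b' k))%:E +
    \sum_(k <oo) (box_volume (a' k) (ab k).2)%:E)%E.
  rewrite -nneseriesD; first 1 last.
  - by move=> k _ _; rewrite lee_fin box_volume_ge0.
  - by move=> k _ _; rewrite lee_fin box_volume_ge0.
  by apply: eq_eseriesr => k _; rewrite -EFinD box_volume_cut.
apply: leeD; apply: lebesgue_outer_cover; split=> // x [/cX [k _ xk] /= xc];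
  exists k => // j; rewrite mxE; case: eqP => [->|_]; try exact: xk.
- have /andP[ax xb] := xk i; rewrite ax le_min xb le_max xc orbT.
  by [].
- have /andP[ax xb] := xk i; rewrite xb andbT gt_min gt_max ax /=.
  by rewrite orbC ltNge; move/negP: xc => ->.
Qed.

Lemma lmeasurable_open_halfspace i (c : R) :
  lebesgue_measurable [set x : 'rV[R]_n.+1 | x 0 i < c].
Proof.
rewrite (_ : [set x | _] =
  \bigcup_k [set x : 'rV[R]_n.+1 | x 0 i <= c - k.+1%:R^-1]).
  by apply: lmeasurable_bigcup => k; exact: lmeasurable_halfspace.
apply/seteqP; split=> x /=; last first.
  by move=> [k _ /= /le_lt_trans]; apply; rewrite ltrBlDr ltrDl invr_gt0.
move=> xc; have := xc; rewrite -subr_gt0 => /ltr_add_invr [k].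
rewrite add0r => kx; exists k => //=.
by rewrite lerBrDr -lerBrDl; exact: ltW.
Qed.

Lemma lmeasurable_box a b : lebesgue_measurable (box a b).
Proof.
rewrite (_ : box a b = [set x | forall i,
    (~` [set y : 'rV[R]_n.+1 | y 0 i <= a 0 i] `&`
     [set y | y 0 i <= b 0 i]) x]).
  apply: lmeasurable_forall => i; apply: lmeasurableI.
    by apply: lmeasurableC; exact: lmeasurable_halfspace.
  exact: lmeasurable_halfspace.
apply/seteqP; split=> x /= xab i.
- by have /andP[ax xb] := xab i; split=> //; apply/negP; rewrite -ltNge.
- by have [/negP ax xb] := xab i; rewrite ltNge ax xb.
Qed.

Lemma lmeasurable_cube x (r : R) : lebesgue_measurable (cube x r).
Proof.
rewrite (_ : cube x r = [set y | forall i,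
    (~` [set z : 'rV[R]_n.+1 | z 0 i <= x 0 i - r / 2] `&`
     [set z | z 0 i < x 0 i + r / 2]) y]).
  apply: lmeasurable_forall => i; apply: lmeasurableI.
    by apply: lmeasurableC; exact: lmeasurable_halfspace.
  exact: lmeasurable_open_halfspace.
apply/seteqP; split=> y /= xy i; have := xy i.
- rewrite ltr_distl => /andP[yl yr]; split=> //.
  by apply/negP; rewrite -ltNge.
- move=> [/negP]; rewrite -ltNge => yl yr.
  by rewrite ltr_distl yl yr.
Qed.

Lemma lebesgue_outer_translate A x : lam (translate A x) = lam A.
Proof.
have le B y : (lam (translate B y) <= lam B)%E.
  apply: le_ereal_inf_tmp => _ [a [b [[ab Bab] ->]]].
  have -> : (\sum_(k <oo) (box_volume (a k) (b k))%:E =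
      \sum_(k <oo) (box_volume (a k + y) (b k + y))%:E)%E.
    apply: eq_eseriesr => k _; congr (_%:E); apply: eq_bigr => i _.
    by rewrite !mxE; ring.
  apply: (lebesgue_outer_cover (a := fun k => a k + y) (b := fun k => b k + y)).
  split=> [k i|_ [z /Bab [k _ zk] <-]]; first by rewrite !mxE lerD2r.
  by exists k => // i; rewrite !mxE ltrD2r lerD2r; exact: zk.
apply/eqP; rewrite eq_le le /=.
have := le (translate A x) (- x); congr (lam _ <= _)%E.
apply/seteqP; split=> [_ [_ [z Az <-] <-]|z Az]; first by rewrite addrK.
by exists (z + x); [exists z|rewrite addrK].
Qed.

End MeasurableSets.

(** * Dyadic cells *)
Section DyadicCells.
Context {R : realType} {n : nat}.
Implicit Types (A B U : set 'rV[R]_n.+1) (x y : 'rV[R]_n.+1) (k l N : nat).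
Local Notation lam := (@lebesgue_outer R n.+1).

(** The dyadic cubes are half-open, of the form (z-1, z] * 2^-k coordinatewise,
and are handled through the index [z] of the cube of level [k] containing a
point. *)
Definition cell_index k x : {ffun 'I_n.+1 -> int} :=
  [ffun i => Num.ceil (2 ^+ k * x 0 i)].

Definition cell k x : set 'rV[R]_n.+1 := [set y | cell_index k y = cell_index k x].

(** The unions of cells of level [k]. *)
Definition cellwise k U := forall x y, cell_index k x = cell_index k y -> U x -> U y.

Definition grid_shift k (z : 'I_n.+1 -> int) : 'rV[R]_n.+1 :=
  \row_i ((z i)%:~R / 2 ^+ k).

Definition window N : set 'rV[R]_n.+1 :=
  box (const_mx (- N%:R)) (const_mx N%:R).

Lemma pow2_gt0 k : 0 < 2 ^+ k :> R. Proof. exact: exprn_gt0. Qed.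

Lemma pow2V_small (e : R) : 0 < e ->
  exists K, forall k, (K <= k)%N -> (2 ^+ k)^-1 < e.
Proof.
move=> e0; have ev0 : 0 <= e^-1 by rewrite invr_ge0 ltW.
exists (Num.bound e^-1) => k Kk.
rewrite -[ltRHS]invrK ltf_pV2 ?posrE ?pow2_gt0 ?invr_gt0 //.
apply: lt_le_trans (archi_boundP ev0) _; rewrite -natrX ler_nat.
by apply: leq_trans Kk _; apply: ltnW; exact: ltn_expl.
Qed.

Lemma cell_refl k x : cell k x x. Proof. by []. Qed.

Lemma cell_sub k U x : cellwise k U -> U x -> cell k x `<=` U.
Proof. by move=> UU Ux y xy; apply: UU Ux. Qed.

Lemma cellP k x y : cell k x y <->
  forall i, (cell_index k x i - 1)%:~R / 2 ^+ k < y 0 i <=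
            (cell_index k x i)%:~R / 2 ^+ k.
Proof.
have p := pow2_gt0 k.
split=> [xy i|xy].
  have -> : cell_index k x i = Num.ceil (2 ^+ k * y 0 i) by rewrite -xy ffunE.
  by rewrite ltr_pdivrMr // ler_pdivlMr // mulrC ceil_itv.
apply/ffunP => i; rewrite ffunE; apply: ceil_def.
by have := xy i; rewrite ltr_pdivrMr // ler_pdivlMr // mulrC.
Qed.

Lemma lmeasurable_cell k x : lebesgue_measurable (cell k x).
Proof.
rewrite (_ : cell k x = box (\row_i ((cell_index k x i - 1)%:~R / 2 ^+ k))
                            (\row_i ((cell_index k x i)%:~R / 2 ^+ k))).
  exact: lmeasurable_box.
apply/seteqP; split=> y; first by move=> /cellP xy i; rewrite !mxE; exact: xy.
by move=> xy; apply/cellP => i; have := xy i; rewrite !mxE.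
Qed.

Lemma cell_dist k x y i : cell k x y -> `|y 0 i - x 0 i| < (2 ^+ k)^-1.
Proof.
move=> /cellP/(_ i)/andP[yl yr].
have /cellP/(_ i)/andP[xl xr] := cell_refl k x.
move: yl yr xl xr; rewrite intrB mulrBl mul1r => yl yr xl xr.
by rewrite ltr_norml; apply/andP; split; lra.
Qed.

(** Dyadic cubes are nested: for an integer [m], being at most [m] at level [k]
is being at most [2^(l-k) * m] at level [l]. *)
Lemma cell_index_coarsen k l x y : (k <= l)%N ->
  cell_index l x = cell_index l y -> cell_index k x = cell_index k y.
Proof.
move=> kl xy; apply/ffunP => i; rewrite !ffunE.
suff le u v : cell_index l u = cell_index l v ->
    Num.ceil (2 ^+ k * u 0 i) <= Num.ceil (2 ^+ k * v 0 i).
  by apply/eqP; rewrite eq_le !le.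
move=> uv; rewrite ceil_le_int.
move: uv; rewrite -(subnK kl); move: (l - k)%N => m /ffunP/(_ i).
rewrite !ffunE => uv.
have p := pow2_gt0 m.
have vm : 2 ^+ (m + k) * v 0 i <= (2 ^ m * Num.ceil (2 ^+ k * v 0 i))%:~R.
  by rewrite intrM exprD -mulrA rmorphXn /= ler_wpM2l ?ceil_ge // ltW.
rewrite -ceil_le_int in vm.
have : Num.ceil (2 ^+ (m + k) * u 0 i) <= 2 ^ m * Num.ceil (2 ^+ k * v 0 i).
  by rewrite uv.
rewrite ceil_le_int.
by rewrite intrM exprD -mulrA rmorphXn /= ler_pM2l.
Qed.

Lemma cellwiseC k U : cellwise k U -> cellwise k (~` U).
Proof. by move=> UU x y xy nUx Uy; apply: nUx; apply: UU Uy. Qed.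

Lemma cellwiseI k U V : cellwise k U -> cellwise k V -> cellwise k (U `&` V).
Proof. by move=> UU VV x y xy [Ux Vx]; split; [apply: UU Ux|apply: VV Vx]. Qed.

(** The half-open windows have integer sides, so they are unions of cells of
every level; this is what permits cutting them along all grids at once. *)
Lemma windowP k N x : window N x <->
  forall i, - (N%:Z * 2 ^ k) < cell_index k x i <= N%:Z * 2 ^ k.
Proof.
have p := pow2_gt0 k.
have key i : (- N%:R < x 0 i <= N%:R) =
    (- (N%:Z * 2 ^ k) < cell_index k x i <= N%:Z * 2 ^ k).
  rewrite ffunE ceil_le_int ceil_gt_int intrN intrM rmorphXn /=.
  by rewrite -mulNr !(mulrC _ (2 ^+ k)) ltr_pM2l // ler_pM2l.
split=> wu i; have := wu i; rewrite ?mxE; first by rewrite key.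
by rewrite -key.
Qed.

Lemma window_homo N M : (N <= M)%N -> window N `<=` window M.
Proof.
rewrite -(ler_nat R) => NM x xN i; have := xN i; rewrite !mxE => /andP[xl xr].
by apply/andP; split; lra.
Qed.

Lemma window_cellwise k N : cellwise k (window N).
Proof. by move=> x y xy /(windowP k) wx; apply/(windowP k) => i; rewrite -xy. Qed.

Let code k x : nat := pickle (cell_index k x).

(** Numbering the cells by [pickle] makes their disjoint union a sequence, as
countable additivity requires; the numbers that are not codes give empty
parts. *)
Lemma cellwise_partition k U :
  [/\ U = \bigcup_j (U `&` [set x | code k x = j]),
      trivIset setT (fun j => U `&` [set x | code k x = j]) &
      cellwise k U -> forall j, U `&` [set x | code k x = j] = set0 \/
        exists2 x, U x & U `&` [set x | code k x = j] = cell k x].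
Proof.
split.
- by apply/seteqP; split=> [x Ux|x [j _ []//]]; exists (code k x).
- by apply/trivIsetP => i j _ _ /eqP ij; apply/seteqP; split=> // x /= [[_ ->] []].
move=> UU j; have [[x [Ux xj]]|no] :=
  pselect (exists x, U x /\ code k x = j).
  right; exists x => //; apply/seteqP; split=> y.
    by move=> [Uy /=]; rewrite -xj => /(pcan_inj pickleK).
  by move=> xy; split; [apply: UU Ux; rewrite xy|rewrite /= -xj /code xy].
by left; apply/seteqP; split=> // x [Ux xj]; apply: no; exists x.
Qed.

Lemma lmeasurable_cellwise k U : cellwise k U -> lebesgue_measurable U.
Proof.
move=> UU; have [defU _ /(_ UU) part] := cellwise_partition k U.
rewrite defU.
apply: lmeasurable_bigcup => j; have [->|[x _ ->]] := part j.
  exact: lmeasurable0.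
exact: lmeasurable_cell.
Qed.

(** Densities are compared cell by cell: both sides are the sums of their parts
in the countably many cells that make up [U]. *)
Lemma cellwise_compare k U A B (c : R) : 0 <= c -> cellwise k U ->
  lebesgue_measurable A -> lebesgue_measurable B ->
  (forall x, U x -> (lam (A `&` cell k x) <= c%:E * lam (B `&` cell k x))%E) ->
  (lam (A `&` U) <= c%:E * lam (B `&` U))%E.
Proof.
move=> c0 UU mA mB leAB; have [defU tU /(_ UU) part] := cellwise_partition k U.
set F := fun j => U `&` [set x | code k x = j] in defU tU part.
have mF j : lebesgue_measurable (F j).
  rewrite /F; have [->|[x _ ->]] := part j; first exact: lmeasurable0.
  exact: lmeasurable_cell.
have sum C : lebesgue_measurable C ->
    lam (C `&` U) = (\sum_(j <oo) lam (C `&` F j))%E.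
  move=> mC; rewrite {1}defU setI_bigcupr -!lebesgueE.
  rewrite (@measure_semi_bigcup _ _ _ (@lebesgue R n)).
  - by [].
  - by move=> j; apply: lmeasurableI => //; exact: mF.
  - exact: trivIset_setIl.
  - by apply: lmeasurable_bigcup => j; apply: lmeasurableI => //; exact: mF.
rewrite (sum A mA) (sum B mB) -nneseriesZl; last first.
  by move=> j _; exact: lebesgue_outer_ge0.
apply: lee_nneseries => [j _ _|j _]; first exact: lebesgue_outer_ge0.
rewrite /F; have [->|[x Ux ->]] := part j; last exact: leAB.
by rewrite !setI0 lebesgue_outer0 mule0.
Qed.

End DyadicCells.

(** * Cells and the cubes that define zooming out *)
Section CubesAndCells.
Context {R : realType} {n : nat}.
Implicit Types (A B U : set 'rV[R]_n.+1) (x y : 'rV[R]_n.+1) (k l N : nat).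
Local Notation lam := (@lebesgue_outer R n.+1).

Lemma cell_index_shift k x z i :
  cell_index k (x + grid_shift k z) i = cell_index k x i + z i.
Proof.
rewrite !ffunE !mxE mulrDr mulrCA divff ?mulr1 ?lt0r_neq0 ?pow2_gt0 //.
by rewrite ceilDrz ?intrKceil // rpred_int.
Qed.

Lemma translate_cell k x z :
  translate (cell k x) (grid_shift k z) = cell k (x + grid_shift k z).
Proof.
apply/seteqP; split=> [_ [y xy <-]|y /ffunP xy].
  by apply/ffunP => i; rewrite !cell_index_shift xy.
exists (y - grid_shift k z); last by rewrite subrK.
apply/ffunP => i; apply: (addIr (z i)).
by rewrite -!cell_index_shift subrK xy.
Qed.

(** Any two cells of the same level are translates of each other by a grid
vector. *)
Lemma lam_cell k x y : lam (cell k x) = lam (cell k y).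
Proof.
pose z i := cell_index k y i - cell_index k x i.
rewrite -(lebesgue_outer_translate _ (grid_shift k z)) translate_cell.
rewrite /cell (_ : cell_index k _ = cell_index k y) //; apply/ffunP => i.
by rewrite cell_index_shift /z; ring.
Qed.

Lemma cell_cube k x : cell k x `<=` cube x (2 / 2 ^+ k).
Proof.
move=> y /cell_dist xy i; rewrite mulrAC divff ?mul1r //; exact: xy.
Qed.

(** The offsets 0, 1, 2 stand for -1, 0, 1: a base point in each of the 3^d
cells that touch the cell of [x], including that cell itself. *)
Definition neighbor k x (o : {ffun 'I_n.+1 -> 'I_3}) : 'rV[R]_n.+1 :=
  x + grid_shift k (fun i => (o i)%:Z - 1).

(** The cube of side [2 * 2^-k] reaches less than one cell side away from its
center, so each coordinate of the index changes by at most one. *)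
Lemma cube_neighbors k x :
  cube x (2 / 2 ^+ k) `<=` \bigcup_o cell k (neighbor k x o).
Proof.
have p := pow2_gt0 (R := R) k.
have near (u v : 'rV[R]_n.+1) i : `|u 0 i - v 0 i| < (2 ^+ k)^-1 ->
    cell_index k u i <= cell_index k v i + 1.
  move=> uv; rewrite !ffunE ceil_le_int intrD.
  have : 2 ^+ k * u 0 i - 2 ^+ k * v 0 i < 1.
    rewrite -mulrBr mulrC -ltr_pdivlMr // div1r.
    exact: le_lt_trans (ler_norm _) uv.
  by have := ceil_ge (2 ^+ k * v 0 i); lra.
move=> y xy.
have {}xy i : `|y 0 i - x 0 i| < (2 ^+ k)^-1.
  by have := xy i; rewrite mulrAC divff ?mul1r.
pose o : {ffun 'I_n.+1 -> 'I_3} :=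
  [ffun i => inord (absz (cell_index k y i - cell_index k x i + 1))].
exists o => //; apply/ffunP => i; rewrite cell_index_shift.
have yx := near y x i (xy i).
have {xy}yx' : cell_index k x i <= cell_index k y i + 1 by apply: near; rewrite distrC.
have [m mE] : exists m : nat, cell_index k y i - cell_index k x i + 1 = m%:Z.
  exists (absz (cell_index k y i - cell_index k x i + 1)).
  by rewrite gez0_abs //; lia.
have -> : (o i : nat) = m by rewrite /o ffunE mE inordK //; lia.
by rewrite -mE; ring.
Qed.

Lemma lam_cube_neighbors k x B (c : R) : 0 <= c ->
  (forall o, lam (cell k (neighbor k x o) `&` B) <= c%:E)%E ->
  (lam (cube x (2 / 2 ^+ k) `&` B) <= (3 ^+ n.+1 * c)%:E)%E.
Proof.
move=> c0 le_c.
have : (lam (cube x (2 / 2 ^+ k) `&` B) <=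
    \sum_(o : {ffun 'I_n.+1 -> 'I_3}) lam (cell k (neighbor k x o) `&` B))%E.
  apply: le_trans (lebesgue_outer_bigU _).
  by apply: le_lebesgue_outer => y [/cube_neighbors [j _ jy] By]; exists j.
move/le_trans; apply.
apply: le_trans (lee_sum _ (fun o _ => le_c o)) _.
rewrite sumEFin lee_fin sumr_const card_ffun !card_ord -[leLHS]mulr_natl natrX.
by [].
Qed.

Lemma lam_cube x (r : R) : lam (cube x r) = lam (cube (0 : 'rV[R]_n.+1) r).
Proof.
rewrite -[RHS](lebesgue_outer_translate _ x); congr (lam _).
apply/seteqP; split=> [y xy|_ [y y0 <-] i].
  exists (y - x); last by rewrite subrK.
  by move=> i; have := xy i; rewrite !mxE subr0.
by have := y0 i; rewrite !mxE subr0 addrK.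
Qed.

Lemma cube_le x (r s : R) : r <= s -> cube x r `<=` cube x s.
Proof. by move=> rs y xy i; apply: lt_le_trans (xy i) _; rewrite ler_pM2r. Qed.

(** An open set is the countable union of the cells that it contains, because a
small enough cell around a point fits into the given cube. *)
Lemma lmeasurable_cube_open U :
  (forall x, U x -> exists2 r : R, 0 < r & cube x r `<=` U) ->
  lebesgue_measurable U.
Proof.
move=> openU; rewrite (_ : U = \bigcup_k [set x | cell k x `<=` U]).
  apply: lmeasurable_bigcup => k; apply: (@lmeasurable_cellwise _ _ k).
  by move=> x y xy; rewrite /= /cell xy.
apply/seteqP; split=> [x /openU [r r0 xU]|x [k _]]; last by apply; exact: cell_refl.
have [k /(_ k (leqnn k)) rk] := pow2V_small (divr_gt0 r0 (ltr0n R 2)).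
exists k => //; apply: subset_trans xU.
by apply: subset_trans (@cell_cube k x) _; apply: cube_le; lra.
Qed.

(** The mass that [A] has in [cube x delta] is nearly attained in a slightly
smaller cube with the same center, and all the cubes of side [delta] with nearby
centers contain that smaller cube. *)
Lemma zooming_out_open (delta eps : R) A x : 0 < delta -> lebesgue_measurable A ->
  zooming_out delta eps A x ->
  exists2 r : R, 0 < r & cube x r `<=` zooming_out delta eps A.
Proof.
move=> delta0 mA; rewrite /zooming_out /= => xZ.
pose q k : R := delta - (2 ^+ k)^-1.
have q_lt k : q k < delta by rewrite gtrBl invr_gt0 pow2_gt0.
have q_homo k l : (k <= l)%N -> q k <= q l.
  move=> kl; rewrite lerD2l lerN2 lef_pV2 ?posrE ?pow2_gt0 //.
  by rewrite ler_weXn2l // ler1n.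
have q_near (e : R) : e < delta -> \forall k \near \oo, e < q k.
  rewrite -subr_gt0 => /pow2V_small [K Kq]; exists K => // k /= /Kq.
  by rewrite /q; lra.
have [k kZ] : exists k,
    (eps%:E * lam (cube x delta) < lam (cube x (q k) `&` A))%E.
  apply: contrapT => /forallNP le_k.
  pose F k := cube x (q k) `&` A.
  have mF k : lebesgue_measurable (F k).
    by apply: lmeasurableI => //; exact: lmeasurable_cube.
  have Fcup : cube x delta `&` A = \bigcup_k F k.
    apply/seteqP; split=> [y [xy Ay]|y [k _ [xy Ay]]]; last first.
      by split=> //; apply: cube_le xy; exact: ltW.
    have [k yk] : exists k, forall i, 2 * `|y 0 i - x 0 i| < q k.
      have /filter_ex [k yk] : \forall k \near \oo,
          forall i, 2 * `|y 0 i - x 0 i| < q k.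
        by apply: filter_forall => i; apply: q_near; have := xy i; lra.
      by exists k.
    by exists k => //; split=> // i; have := yk i; lra.
  have : (lam (cube x delta `&` A) <= eps%:E * lam (cube x delta))%E.
    rewrite Fcup; have Fcvg := @nondecreasing_cvg_mu _ _ _ (@lebesgue R n) F mF.
    have {}Fcvg : (lam \o F) k @[k --> \oo] --> lam (\bigcup_k F k).
      apply: Fcvg; first exact: lmeasurable_bigcup.
      move=> k l kl; apply/subsetPset => y [xy Ay]; split=> //.
      by apply: cube_le xy; exact: q_homo.
    rewrite -(cvg_lim _ Fcvg) //; apply: lime_le.
      by apply/cvg_ex; eexists; exact: Fcvg.
    by near=> k; rewrite /= leNgt; apply/negP; exact: le_k.
  by rewrite leNgt xZ.
exists (delta - q k); first by rewrite subr_gt0.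
move=> y xy; rewrite /= lam_cube -(lam_cube x); apply: lt_le_trans kZ _.
apply: le_lebesgue_outer => z [xz Az]; split=> // i.
rewrite -(subrK (x 0 i) (z 0 i)) -addrA.
apply: le_lt_trans (ler_normD _ _) _.
have := xz i; have := xy i; rewrite distrC; lra.
Unshelve. all: by end_near. Qed.

Lemma lmeasurable_zooming_out (delta eps : R) A : 0 < delta ->
  lebesgue_measurable A -> lebesgue_measurable (zooming_out delta eps A).
Proof.
by move=> delta0 mA; apply: lmeasurable_cube_open => x; exact: zooming_out_open.
Qed.

Lemma lam_window_fin N : (lam (window N) < +oo)%E.
Proof.
apply: le_lt_trans (lebesgue_outer_box _) _; last exact: ltry.
by move=> i; rewrite !mxE; have := ler0n R N; lra.
Qed.

Lemma finite_window_cells k N :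
  finite_set (cell_index k @` (window N : set 'rV[R]_n.+1)).
Proof.
pose M := (N * 2 ^ k)%N.
pose G (f : {ffun 'I_n.+1 -> 'I_(2 * M).+1}) : {ffun 'I_n.+1 -> int} :=
  [ffun i => (f i)%:Z - M%:Z].
apply: (@sub_finite_set _ _ (range G)); last exact: finite_image.
move=> _ [x xN <-].
have bd := (windowP k N x).1 xN.
have ME : M%:Z = N%:Z * 2 ^ k by rewrite /M -natz natrM natrX !natz.
have Mf i : exists m : nat, (m < (2 * M).+1)%N /\ cell_index k x i + M%:Z = m%:Z.
  have := bd i; exists (absz (cell_index k x i + M%:Z)); rewrite gez0_abs; lia.
exists [ffun i => inord (absz (cell_index k x i + M%:Z))] => //.
apply/ffunP => i; rewrite /G ffunE ffunE.
have [m [mM mE]] := Mf i; rewrite mE absz_nat inordK // -mE; ring.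
Qed.

End CubesAndCells.

(** * Cores are dense at most of their points *)
Section Density.
Context {R : realType} {n : nat}.
Implicit Types (A B U V : set 'rV[R]_n.+1) (x y : 'rV[R]_n.+1) (k l N : nat).
Local Notation lam := (@lebesgue_outer R n.+1).

Lemma tail_small (W : nat -> set 'rV[R]_n.+1) B (e : R) :
  (forall k, lebesgue_measurable (W k)) -> (forall k l, (k <= l)%N -> W k `<=` W l) ->
  lebesgue_measurable B -> (lam B < +oo)%E -> 0 < e ->
  exists K, (lam (B `&` ((\bigcup_k W k) `\` W K)) <= e%:E)%E.
Proof.
move=> mW W_homo mB Bfin e0; apply: contrapT => /forallNP tail_big.
pose F k := B `&` ((\bigcup_k W k) `\` W k).
have mF k : lebesgue_measurable (F k).
  by apply/lmeasurableI/lmeasurableD => //; exact: lmeasurable_bigcup.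
have F0 : \bigcap_k F k = set0.
  by apply/seteqP; split=> // x Fx; have [_ [[k _ Wk] _]] := Fx 0%N I;
    have [_ []] := Fx k I.
have : (lam \o F) k @[k --> \oo] --> lam (\bigcap_k F k).
  apply: (@nonincreasing_cvg_mu _ _ _ (@lebesgue R n) F) => //.
  - by apply: le_lt_trans Bfin; apply: le_lebesgue_outer => x [].
  - by rewrite F0; exact: lmeasurable0.
  - move=> k l kl; apply/subsetPset => x [Bx [Wx nWx]]; split=> //; split=> //.
    by move=> /(W_homo k l kl).
rewrite F0 lebesgue_outer0 => Fcvg.
have : (e%:E <= 0%E)%E.
  rewrite -(cvg_lim _ Fcvg) //; apply: lime_ge.
    by apply/cvg_ex; eexists; exact: Fcvg.
  by near=> k; rewrite /= ltW // ltNge; apply/negP; exact: tail_big.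
by rewrite lee_fin leNgt e0.
Unshelve. all: by end_near. Qed.

(** The enclosing box is half-open, so it has to extend beyond the slab on its
open side; the factor 3 leaves room for that. *)
Lemma slab_small N i (t s : R) : 0 < s ->
  (lam (window N `&` [set x : 'rV[R]_n.+1 | (`|x 0 i - t| <= s)%R]) <=
    (3 * s * \prod_(j < n.+1 | j != i) (N%:R + N%:R))%R%:E)%E.
Proof.
move=> s0; pose a : 'rV[R]_n.+1 := \row_j if j == i then t - 2 * s else - N%:R.
pose b : 'rV[R]_n.+1 := \row_j if j == i then t + s else N%:R.
apply: (@le_trans _ _ (lam (box a b))).
  apply: le_lebesgue_outer => x [xN /= xt] j; rewrite !mxE.
  case: eqP => [->|_]; last by have := xN j; rewrite !mxE.
  by move: xt; rewrite ler_distl => /andP[xl xr]; rewrite xr andbT; lra.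
apply: le_trans (lebesgue_outer_box _) _.
  by move=> j; rewrite !mxE; have := ler0n R N; case: eqP => _; lra.
rewrite lee_fin /box_volume (bigD1 i) //= !mxE eqxx.
rewrite (eq_bigr (fun=> N%:R + N%:R)); last first.
  by move=> j /negbTE ji; rewrite !mxE ji opprK.
apply: ler_wpM2r; last by lra.
by apply: prodr_ge0 => j _; rewrite addr_ge0.
Qed.

(** If the small cube around [x] leaves the cell of [x], then [x] is close to a
hyperplane of the grid of level [K], and only finitely many of these
hyperplanes meet the window. *)
Lemma boundary_layer_small K N (e : R) : 0 < e -> exists L0, forall L, (L0 <= L)%N ->
  (lam (window N `&` [set x : 'rV[R]_n.+1 | ~ (cube x (2 / 2 ^+ L) `<=` cell K x)])
    <= e%:E)%E.
Proof.
move=> e0; pose M := (N * 2 ^ K)%N.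
have ME : M%:Z = N%:Z * 2 ^ K by rewrite /M -natz natrM natrX !natz.
pose C : R := \sum_(i < n.+1) \sum_(j < (2 * M).+1)
  (3 * \prod_(j < n.+1 | j != i) (N%:R + N%:R)).
have C0 : 0 <= C.
  apply: sumr_ge0 => i _; apply: sumr_ge0 => j _; apply: mulr_ge0 => //.
  by apply: prodr_ge0 => ? _; rewrite addr_ge0.
have [L0 L0P] := pow2V_small (divr_gt0 e0 (ltr_wpDl C0 ltr01)).
exists L0 => L /L0P; set s := (2 ^+ L)^-1 => sC.
have s0 : 0 < s by rewrite invr_gt0 pow2_gt0.
pose t (j : 'I_(2 * M).+1) : R := (j%:Z - M%:Z)%:~R / 2 ^+ K.
pose slab i j := window N `&` [set x : 'rV[R]_n.+1 | `|x 0 i - t j| <= s].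
apply: (@le_trans _ _ (lam [set x | exists i, [set x | exists j, slab i j x] x])).
  apply: le_lebesgue_outer => x [xN /= /existsNP[y /not_implyP[xy nxy]]].
  have /existsNP[i /eqP index_neq] : ~ forall i, cell_index K y i = cell_index K x i.
    by move=> e1; apply: nxy; apply/ffunP.
  exists i => /=.
  have xs : `|y 0 i - x 0 i| < s by have := xy i; rewrite mulrAC divff ?mul1r.
  have [/(_ i)/andP[xl xr] /(_ i)/andP[yl yr]] :=
    ((cellP K x x).1 (cell_refl K x), (cellP K y y).1 (cell_refl K y)).
  have /(_ i)/andP[Ml Mr] := (windowP K N x).1 xN.
  have p := pow2_gt0 (R := R) K.
  (* [j - M] runs over the indices [z] of the grid hyperplanes [x_i = z * 2^-K]
     that meet the closed window. *)
  have wit (z : int) : - M%:Z <= z <= M%:Z -> `|x 0 i - z%:~R / 2 ^+ K| <= s ->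
      exists j, slab i j x.
    move=> zM xz; have [j jz] : exists j : nat, z + M%:Z = j%:Z.
      by exists (absz (z + M%:Z)); rewrite gez0_abs; lia.
    have jM : (j < (2 * M).+1)%N by lia.
    exists (Ordinal jM); split=> //=; rewrite /t /= -jz addrK.
    exact: xz.
  move: xs; rewrite ltr_distl => /andP[xsl xsr].
  have := index_neq.
  case: (ltgtP (cell_index K y i) (cell_index K x i)) => // [yx _|xy_index _].
  - apply: (wit (cell_index K x i - 1)); first by lia.
    have : y 0 i <= (cell_index K x i - 1)%:~R / 2 ^+ K.
      by apply: le_trans yr _; rewrite ler_pM2r ?invr_gt0 // ler_int; lia.
    by move=> yz; rewrite ler_distl; apply/andP; split; lra.
  - apply: (wit (cell_index K x i)); first by lia.
    have : (cell_index K x i)%:~R / 2 ^+ K < y 0 i.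
      by apply: le_lt_trans yl; rewrite ler_pM2r ?invr_gt0 // ler_int; lia.
    by move=> yz; rewrite ler_distl; apply/andP; split; lra.
apply: le_trans (lebesgue_outer_bigU _) _.
apply: (@le_trans _ _ (C * s)%:E).
  rewrite /C mulr_suml -sumEFin; apply: lee_sum => i _.
  apply: le_trans (lebesgue_outer_bigU _) _.
  rewrite mulr_suml -sumEFin; apply: lee_sum => j _.
  by apply: le_trans (slab_small _ _ _ s0) _; rewrite lee_fin mulrAC.
rewrite lee_fin; move: sC; rewrite ltr_pdivlMr; last by lra.
nra.
Qed.

End Density.

Section DensityPoints.
Context {R : realType} {n : nat}.
Implicit Types (A B U V G : set 'rV[R]_n.+1) (x y : 'rV[R]_n.+1) (k l N : nat).
Local Notation lam := (@lebesgue_outer R n.+1).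

Lemma lam_bounded_fin A N : A `<=` window N -> lam A \is a fin_num.
Proof.
move=> AN; rewrite ge0_fin_numE ?lebesgue_outer_ge0 //.
by apply: le_lt_trans (lam_window_fin N); exact: le_lebesgue_outer.
Qed.

Lemma lam_cell_fin k x : lam (cell k x) \is a fin_num.
Proof.
have -> : lam (cell k x) = lam (cell k (const_mx 1)) by exact: lam_cell.
apply: (@lam_bounded_fin _ 1); apply: cell_sub; first exact: window_cellwise.
by move=> i; rewrite !mxE; lra.
Qed.

Lemma lam_cube_fin k x : lam (cube x (2 / 2 ^+ k)) \is a fin_num.
Proof.
rewrite ge0_fin_numE ?lebesgue_outer_ge0 // -[cube _ _]setIT.
apply: le_lt_trans (lam_cube_neighbors (c := fine (lam (cell k x))) _ _) _.
- by rewrite fine_ge0 ?lebesgue_outer_ge0.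
- by move=> o; rewrite setIT fineK ?lam_cell_fin // (lam_cell k _ x).
- exact: ltry.
Qed.

Lemma lam_cube_le_cell k x y :
  (lam (cube x (2 / 2 ^+ k)) <= (3 ^+ n.+1)%:E * lam (cell k y))%E.
Proof.
rewrite -[cube _ _]setIT -(fineK (lam_cell_fin k y)) -EFinM.
apply: lam_cube_neighbors; first by rewrite fine_ge0 ?lebesgue_outer_ge0.
by move=> o; rewrite setIT fineK ?lam_cell_fin // (lam_cell k _ y).
Qed.

Lemma cube_window L N x : window N x -> cube x (2 / 2 ^+ L) `<=` window N.+1.
Proof.
move=> xN y xy i; have := xN i; have := xy i; rewrite !mxE.
have : (2 ^+ L)^-1 <= 1 :> R by rewrite invf_le1 ?pow2_gt0 // exprn_ege1 // ler1n.
rewrite mulrAC divff ?mul1r // -natr1 ltr_distl.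
by move=> L1 /andP[yl yr] /andP[xl xr]; apply/andP; split; lra.
Qed.

(** A weak-type inequality at a single scale. The cube around [x] is covered by
3^d cells, so one of them is filled by [V] up to the proportion [e / (2 * 3^d)];
such cells are disjoint, so their total measure is at most [2 * 3^d / e] times
that of [V], and [x] lies in one of the 3^d translates of their union. The
factor 2 turns the pigeonhole into a strict inequality. *)
Lemma dense_cubes_small L V (e : R) : 0 < e -> lebesgue_measurable V ->
  (lam [set x | e%:E * lam (cube x (2 / 2 ^+ L)) <=
                lam (cube x (2 / 2 ^+ L) `&` V)]
     <= (3 ^+ n.+1 * (2 * 3 ^+ n.+1 / e))%:E * lam V)%E.
Proof.
move=> e0 mV; have p3 : 0 < 3 ^+ n.+1 :> R by rewrite exprn_gt0.
have [c cE] : exists c : R, c = e / (2 * 3 ^+ n.+1) by exists (e / (2 * 3 ^+ n.+1)).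
have c0 : 0 < c by rewrite cE divr_gt0 // mulr_gt0.
pose H := [set x | (c%:E * lam (cell L x) <= lam (V `&` cell L x))%E].
have cH : cellwise L H by move=> x y xy; rewrite /H /cell /= xy.
have lamH : (lam H <= (c^-1)%:E * lam V)%E.
  rewrite -[H]setTI.
  have := cellwise_compare (A := setT) (B := V) (c := c^-1) _ cH.
  move=> /(_ _ _ _ _)/le_trans; apply => //.
  - by rewrite invr_ge0 ltW.
  - exact: lmeasurableT.
  - move=> x Hx; rewrite setTI.
    apply: le_trans (lee_wpmul2l _ Hx); last by rewrite lee_fin invr_ge0 ltW.
    by rewrite muleA -EFinM mulVf ?mul1e // lt0r_neq0.
  - apply: lee_wpmul2l; first by rewrite lee_fin invr_ge0 ltW.
    by apply: le_lebesgue_outer => x [].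
apply: (@le_trans _ _ (lam [set x | exists o, H (neighbor L x o)])).
  apply: le_lebesgue_outer => x /= eQ; apply: contrapT => /forallNP noH.
  have := eQ; apply/negP; rewrite -ltNge.
  apply: le_lt_trans (lam_cube_neighbors (c := c * fine (lam (cell L x))) _ _) _.
  - by rewrite mulr_ge0 ?fine_ge0 ?lebesgue_outer_ge0 // ltW.
  - move=> o; have := noH o; rewrite /H /= => /negP; rewrite -ltNge => /ltW.
    by rewrite setIC EFinM fineK ?lam_cell_fin // (lam_cell L _ x).
  - have [Q QE] : exists Q, lam (cube x (2 / 2 ^+ L)) = Q%:E.
      by exists (fine (lam (cube x (2 / 2 ^+ L)))); rewrite fineK ?lam_cube_fin.
    have [q qE] : exists q, lam (cell L x) = q%:E.
      by exists (fine (lam (cell L x))); rewrite fineK ?lam_cell_fin.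
    have := le_lebesgue_outer (@cell_cube _ _ L x).
    (* If the cells were null, every point would belong to [H]. *)
    have q0 : 0 < q.
      have := noH [ffun=> ord0]; rewrite /H /= => /negP; rewrite -ltNge => V_lt.
      have := le_lt_trans (lebesgue_outer_ge0 _) V_lt.
      by rewrite (lam_cell L _ x) qE -EFinM lte_fin pmulr_rgt0.
    rewrite QE qE /= -EFinM !lee_fin !lte_fin => qQ.
    have -> : 3 ^+ n.+1 * (c * q) = e * q / 2.
      by rewrite cE; field; rewrite lt0r_neq0.
    by nra.
apply: le_trans (lebesgue_outer_bigU _) _.
apply: (@le_trans _ _ (\sum_(o : {ffun 'I_n.+1 -> 'I_3}) (c^-1)%:E * lam V)%E).
  apply: lee_sum => o _; apply: le_trans lamH.
  rewrite -(lebesgue_outer_translate _ (grid_shift L (fun i => (o i)%:Z - 1))).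
  by apply: le_lebesgue_outer => _ [x Hx <-].
have -> : (\sum_(o : {ffun 'I_n.+1 -> 'I_3}) (c^-1)%:E * lam V =
    (3 ^+ n.+1)%:E * ((c^-1)%:E * lam V))%E.
  rewrite -natrX mule_natl; have -> : (3 ^ n.+1)%N = #|{: {ffun 'I_n.+1 -> 'I_3}}|.
    by rewrite card_ffun !card_ord.
  exact: (@sumr_const (\bar R)).
by rewrite muleA -EFinM cE invf_div.
Qed.

(** Most points of the complement [G] of [\bigcup_k W k] see [G] with density
more than [1 - e] at every small scale. Up to a set [V] of small measure the
complement of [G] is [W K], which is a union of cells of level [K]; so if the
cube around a point of [G] stays inside the cell of that point, it meets the
complement of [G] only in [V]. What remains is controlled by
[boundary_layer_small] and [dense_cubes_small]. *)
Lemma density_small (W : nat -> set 'rV[R]_n.+1) N (e eta : R) :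
  (forall k, cellwise k (W k)) -> (forall k l, (k <= l)%N -> W k `<=` W l) ->
  0 < e -> 0 < eta ->
  exists L0, forall L, (L0 <= L)%N ->
    (lam (window N `&` (~` (\bigcup_k W k) `\`
       zooming_out (2 / 2 ^+ L) (1 - e) (~` (\bigcup_k W k)))) <= eta%:E)%E.
Proof.
move=> cW W_homo e0 eta0; set G := ~` _.
have mW k : lebesgue_measurable (W k) by apply: lmeasurable_cellwise (cW k).
have mcupW : lebesgue_measurable (\bigcup_k W k) by exact: lmeasurable_bigcup.
have mN M : lebesgue_measurable (window M : set 'rV[R]_n.+1).
  exact: lmeasurable_box.
pose C : R := 3 ^+ n.+1 * (2 * 3 ^+ n.+1 / e).
have C0 : 0 < C by rewrite mulr_gt0 ?divr_gt0 ?mulr_gt0 ?exprn_gt0.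
have [K] := tail_small mW W_homo (mN N.+1) (lam_window_fin N.+1)
  (divr_gt0 (divr_gt0 eta0 (ltr0n R 2)) C0).
set V := _ `&` _ => lamV.
have mV : lebesgue_measurable V.
  by apply: lmeasurableI => //; exact: lmeasurableD.
have [L0 L0P] := boundary_layer_small (n := n) K N (divr_gt0 eta0 (ltr0n R 2)).
exists L0 => L /L0P layer.
have dense : (lam [set x | e%:E * lam (cube x (2 / 2 ^+ L)) <=
    lam (cube x (2 / 2 ^+ L) `&` V)] <= (eta / 2)%:E)%E.
  apply: le_trans (dense_cubes_small L e0 mV) _.
  apply: (@le_trans _ _ (C%:E * (eta / 2 / C)%:E)%E).
    by apply: lee_wpmul2l => //; rewrite lee_fin ltW.
  by rewrite -EFinM lee_fin mulrC divfK // lt0r_neq0.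
rewrite [eta]splitr EFinD; apply: (le_trans _ (leeD layer dense)).
apply: (le_trans _ (lebesgue_outerU _ _)); apply: le_lebesgue_outer => x [xN [Gx nZ]].
have [xK|] := pselect (cube x (2 / 2 ^+ L) `<=` cell K x); [right|by left].
have mZG : lebesgue_measurable G by exact: lmeasurableC.
set Q := cube x (2 / 2 ^+ L) in xK *.
have Qfin : lam Q \is a fin_num by exact: lam_cube_fin.
have QV : (lam (Q `&` ~` G) <= lam (Q `&` V))%E.
  apply: le_lebesgue_outer => y [Qy /contrapT Wy]; split=> //; split.
    exact: cube_window xN _ Qy.
  split=> // WKy; apply: Gx; exists K => //.
  by apply: cW WKy; exact: xK.
have QG : (lam Q = lam (Q `&` G) + lam (Q `&` ~` G))%E by exact: mZG.
move: nZ QV => /negP; rewrite -leNgt /= -/Q => nZ QV.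
apply: le_trans QV; move: nZ; rewrite QG.
have QGfin : lam (Q `&` G) \is a fin_num.
  rewrite ge0_fin_numE ?lebesgue_outer_ge0 // (le_lt_trans _ (ltry (fine (lam Q)))) //.
  by rewrite fineK //; apply: le_lebesgue_outer => y [].
have QGfin' : lam (Q `&` ~` G) \is a fin_num.
  rewrite ge0_fin_numE ?lebesgue_outer_ge0 // (le_lt_trans _ (ltry (fine (lam Q)))) //.
  by rewrite fineK //; apply: le_lebesgue_outer => y [].
rewrite -(fineK QGfin) -(fineK QGfin') -EFinD -!EFinM !lee_fin; lra.
Qed.

End DensityPoints.

(** * A common sequence of scales *)
Section CommonScales.
Context {R : realType} {n : nat}.
Local Notation lam := (@lebesgue_outer R n.+1).
Variables (G : nat -> set 'rV[R]_n.+1) (e : R).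

Definition dense_at L m : set 'rV[R]_n.+1 :=
  G m `&` zooming_out (2 / 2 ^+ L) (1 - e) (G m).

(** The density is asked for from some index [i0] on, not merely infinitely
often, in order that finitely many points share a scale. *)
Definition density_points (scale : nat -> nat) : set 'rV[R]_n.+1 :=
  [set x | exists m i0, forall i, (i0 <= i)%N -> dense_at (scale i) m x].

Hypothesis mG : forall m, lebesgue_measurable (G m).
Hypothesis G_homo : forall m m', (m <= m')%N -> G m `<=` G m'.
Hypothesis density : forall m N (eta : R), 0 < eta ->
  exists L0, forall L, (L0 <= L)%N ->
    (lam (window N `&` (G m `\` zooming_out (2 / 2 ^+ L) (1 - e) (G m))) <= eta%:E)%E.

Lemma lmeasurable_dense_at L m : lebesgue_measurable (dense_at L m).
Proof.
by apply: lmeasurableI => //; apply: lmeasurable_zooming_out.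
Qed.

Lemma lmeasurable_density_points scale : lebesgue_measurable (density_points scale).
Proof.
rewrite (_ : density_points scale = \bigcup_m \bigcup_i0 \bigcap_i
    (if (i0 <= i)%N then dense_at (scale i) m else setT)).
  apply: lmeasurable_bigcup => m; apply: lmeasurable_bigcup => i0.
  apply: lmeasurable_bigcap => i; case: ifP => _; first exact: lmeasurable_dense_at.
  exact: lmeasurableT.
apply/seteqP; split=> x.
- move=> [m [i0 xm]]; exists m => //; exists i0 => // i _.
  by case: ifPn => // /xm.
- move=> [m _ [i0 _ xm]]; exists m, i0 => i ii0.
  by have := xm i I; rewrite ii0.
Qed.

(** Choosing the [i]-th scale so small that the exceptional sets of the
members of [G] of index at most [i] have measure at most 2^-(i+1) in the [i]-th window makes
these measures summable; the Borel-Cantelli lemma applies to each member. *)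
Lemma exists_scales : exists scale, forall m N,
  lam (window N `&` (G m `\` density_points scale)) = 0%E.
Proof.
have /choice [scale scaleP] : forall i, exists L, forall m, (m <= i)%N ->
    (lam (window i `&` (G m `\` dense_at L m)) <= (1 / (2 ^ i.+1)%:R)%:E)%E.
  move=> i.
  have /filter_ex [L LP] : \forall L \near \oo, forall m : 'I_i.+1,
    (lam (window i `&` (G m `\` zooming_out (2 / 2 ^+ L) (1 - e) (G m))) <=
      (1 / (2 ^ i.+1)%:R)%:E)%E.
    apply: filter_forall => m.
    have [|L0 L0P] := @density m i (1 / (2 ^ i.+1)%:R).
      by rewrite divr_gt0 // ltr0n expn_gt0.
    by exists L0.
  exists L => m mi; have := LP (Ordinal (mi : (m < i.+1)%N)).
  apply: le_trans; apply: le_lebesgue_outer => x [xi [Gx nx]].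
  by split=> //; split=> // Zx; apply: nx.
exists scale => m N.
pose F i := if (m <= i)%N then window i `&` (G m `\` dense_at (scale i) m) else set0.
have mF i : lebesgue_measurable (F i).
  rewrite /F; case: ifP => _; last exact: lmeasurable0.
  apply: lmeasurableI; first exact: lmeasurable_box.
  by apply: lmeasurableD => //; exact: lmeasurable_dense_at.
have F0 : lam (lim_sup_set F) = 0%E.
  apply: (@lim_sup_set_cvg0 _ _ _ (@lebesgue R n)) => //.
  apply: le_lt_trans (ltry 1); apply: le_trans (epsilon_trick0 xpredT ler01).
  apply: lee_nneseries => [i _ _|i _]; first exact: lebesgue_outer_ge0.
  rewrite lebesgueE /F; case: ifP => [mi|_]; first exact: scaleP.
  by rewrite lebesgue_outer0 lee_fin divr_ge0.
apply/eqP; rewrite eq_le lebesgue_outer_ge0 andbT -F0.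
apply: le_lebesgue_outer => x [xN [Gx nx]] k _.
have /existsNP [i /not_implyP [ki xi]] : ~ forall i, (maxn k (maxn m N) <= i)%N ->
    dense_at (scale i) m x.
  by move=> xm; apply: nx; exists m, (maxn k (maxn m N)).
exists i => /=; first by lia.
rewrite /F; have -> : (m <= i)%N by lia.
by split=> //; apply: window_homo xN; lia.
Qed.

Lemma density_points_common scale (S : set 'rV[R]_n.+1) : finite_set S ->
  S `<=` density_points scale -> exists m i, S `<=` dense_at (scale i) m.
Proof.
move=> /finite_seqP [X ->] XD.
have /choice [mi miP] : forall x : 'rV[R]_n.+1, exists mi : nat * nat,
    x \in X -> forall i, (mi.2 <= i)%N -> dense_at (scale i) mi.1 x.
  move=> x; have [/XD [m [i0 xm]]|xX] := boolP (x \in X); first by exists (m, i0).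
  by exists (0%N, 0%N).
pose m := (\max_(x <- X) (mi x).1)%N.
pose i := (\max_(x <- X) (mi x).2)%N.
exists m, i => x xX.
have le_m : ((mi x).1 <= m)%N by exact: leq_bigmax_seq.
have le_i : ((mi x).2 <= i)%N by exact: leq_bigmax_seq.
have [Gx Zx] := miP x xX i le_i; split; first exact: G_homo Gx.
apply: lt_le_trans Zx _; apply: le_lebesgue_outer => y [? Gy]; split=> //.
exact: G_homo Gy.
Qed.

End CommonScales.

(** * The core of a sequence of sets along an ultrafilter *)
Section UltrafilterCore.
Context {R : realType} {n : nat}.
Implicit Types (x y : 'rV[R]_n.+1) (k l N : nat).
Local Notation lam := (@lebesgue_outer R n.+1).
Variables (A : nat -> set 'rV[R]_n.+1) (F : set_system nat).
Hypothesis mA : forall j, lebesgue_measurable (A j).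
Context {FU : UltraFilter F}.

Let FP : ProperFilter F. Proof. exact: ultra_proper. Qed.
Let FF : Filter F. Proof. exact: filter_filter. Qed.

(** A window meets finitely many cells of a given level, so what holds for
ultrafilter-many indices in each of them holds in all of them at once. *)
Lemma near_cells k N (Q : nat -> set 'rV[R]_n.+1 -> Prop) :
  (forall x, window N x -> \forall j \near F, Q j (cell k x)) ->
  \forall j \near F, forall x, window N x -> Q j (cell k x).
Proof.
move=> Qx; have /finite_seqP [X SX] := finite_window_cells (R := R) (n := n) k N.
suff : \forall j \near F, forall z, z \in X ->
    forall x, window N x -> cell_index k x = z -> Q j (cell k x).
  apply: filterS => j Qj x xN; apply: (Qj (cell_index k x)) => //.
  suff : [set` X] (cell_index k x) by [].
  by rewrite -SX; exists x.
have : {subset X <= X} by [].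
elim: {-2}X => [|z Y IHY] YX; first by apply: filterE.
have : [set` X] z by apply: YX; rewrite mem_head.
rewrite -SX => -[y yN yz].
have {}IHY := IHY (fun u uY => YX u (@mem_behead _ (z :: Y) u uY)).
apply: filterS2 IHY (Qx y yN) => j QY Qy u.
rewrite inE => /predU1P[->|/QY//] x _ xz.
by rewrite /cell xz -yz.
Qed.

Definition dense_cells (c : R) k : set 'rV[R]_n.+1 :=
  [set x | \forall j \near F, (c%:E * lam (cell k x) < lam (A j `&` cell k x))%E].

(** The inequality [l < k] is strict so that the family starts with the empty
set, the base case of [sparse_mass]. *)
Definition some_sparse (c : R) k : set 'rV[R]_n.+1 :=
  [set x | exists2 l, (l < k)%N & ~ dense_cells c l x].

Lemma dense_cells_cellwise c k : cellwise k (dense_cells c k).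
Proof. by move=> x y xy; rewrite /dense_cells /cell /= xy. Qed.

Lemma some_sparse_cellwise c k : cellwise k (some_sparse c k).
Proof.
move=> x y xy [l lk nx]; exists l => // ny; apply: nx.
apply: dense_cells_cellwise ny; apply/esym; apply: cell_index_coarsen xy; exact: ltnW.
Qed.

Lemma some_sparse_homo c k l : (k <= l)%N -> some_sparse c k `<=` some_sparse c l.
Proof. by move=> kl x [i ik nx]; exists i => //; exact: leq_trans kl. Qed.

(** Passing from [k] to [k.+1] adds the disjoint set [D] of the sparse cells of
level [k] that lie in no larger sparse cell. A cell that is not dense is filled
up to at most the proportion [c] by ultrafilter-many of the [A j], since
ultrafilters decide. *)
Lemma sparse_mass (c : R) k N : 0 <= c -> \forall j \near F,
  (lam (A j `&` (window N `&` some_sparse c k)) <=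
    c%:E * lam (window N `&` some_sparse c k))%E.
Proof.
move=> c0; elim: k => [|k IHk].
  have -> : window N `&` some_sparse c 0 = set0.
    by apply/seteqP; split=> // x [_ []].
  by apply: filterE => j; rewrite setI0 lebesgue_outer0 mule0.
pose D := (window N `&` ~` dense_cells c k) `&` ~` some_sparse c k.
have cD : cellwise k D.
  apply: cellwiseI; first apply: cellwiseI; first exact: window_cellwise.
    exact/cellwiseC/dense_cells_cellwise.
  exact/cellwiseC/some_sparse_cellwise.
have : \forall j \near F, forall x, window N x -> ~ dense_cells c k x ->
    (lam (A j `&` cell k x) <= c%:E * lam (setT `&` cell k x))%E.
  have : \forall j \near F, forall x, window N x ->
      ~ cell k x `<=` dense_cells c k ->
      (lam (A j `&` cell k x) <= c%:E * lam (setT `&` cell k x))%E.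
    apply: (@near_cells k N (fun j C => ~ C `<=` dense_cells c k ->
      (lam (A j `&` C) <= c%:E * lam (setT `&` C))%E)) => x _.
    have [dx|nx] := pselect (dense_cells c k x).
      apply: filterE => j nd; case: nd; apply: cell_sub dx.
      exact: dense_cells_cellwise.
    have [//|] := in_ultra_setVsetC
      [set j | (c%:E * lam (cell k x) < lam (A j `&` cell k x))%E] FU.
    by apply: filterS => j /= /negP; rewrite -leNgt setTI.
  apply: filterS => j Dj x xN nx; apply: Dj => // dx; apply: nx; exact: dx.
apply: filter_app; apply: filter_app IHk; apply: filterE => j IHj Dj.
have mS : lebesgue_measurable (some_sparse c k).
  exact: lmeasurable_cellwise (@some_sparse_cellwise c k).
have ADj : (lam (A j `&` D) <= c%:E * lam D)%E.
  rewrite -[X in (_ <= _ * lam X)%E]setTI.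
  apply: cellwise_compare cD _ _ _ => // [|x [[xN nx] _]]; last exact: Dj.
  exact: lmeasurableT.
have step : window N `&` some_sparse c k.+1 =
    (window N `&` some_sparse c k) `|` D.
  apply/seteqP; split=> x.
    move=> [xN [l lk nx]].
    have [xk|nxk] := pselect (some_sparse c k x); first by left.
    right; split=> //; split=> // dx; apply: nxk; exists l => //.
    by move: lk; rewrite ltnS leq_eqVlt => /predU1P[lk|//]; rewrite lk in nx.
  move=> [[xN xk]|[[xN nx] _]]; split=> //; first exact: some_sparse_homo xk.
  by exists k.
rewrite step setIUr; apply: le_trans (lebesgue_outerU _ _) _.
apply: le_trans (leeD IHj ADj) _; rewrite -ge0_muleDr ?lebesgue_outer_ge0 //.
apply: lee_wpmul2l; first by rewrite lee_fin.
rewrite (mS (_ `|` D)); apply: leeD; apply: le_lebesgue_outer => x.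
  by move=> [xN xk]; split=> //; left.
by move=> [[xN nx] nxk]; split=> //; right.
Qed.

Definition core (c : R) : set 'rV[R]_n.+1 := ~` (\bigcup_k some_sparse c k).

Lemma core_dense c k : core c `<=` dense_cells c k.
Proof.
move=> x cx; apply: contrapT => nx; apply: cx; exists k.+1 => //.
by exists k.
Qed.

Lemma lmeasurable_core c : lebesgue_measurable (core c).
Proof.
apply/lmeasurableC/lmeasurable_bigcup => k.
exact: lmeasurable_cellwise (@some_sparse_cellwise c k).
Qed.

Lemma core_antimono c c' : c <= c' -> core c' `<=` core c.
Proof.
move=> cc x c'x [k _ [l lk nx]]; apply: nx.
apply: filterS (core_dense l c'x) => j; apply: le_lt_trans.
by rewrite lee_wpmul2r // lebesgue_outer_ge0.
Qed.

(** Inside the window, the complement of [core c] is exhausted, up to measure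
[eta], by the cells that are sparse at finitely many levels; the bound of
[sparse_mass] is uniform in their number. *)
Lemma core_mass (c eta : R) N : 0 <= c -> 0 < eta -> \forall j \near F,
  (lam (A j `&` (window N `\` core c)) <= c%:E * lam (window N) + eta%:E)%E.
Proof.
move=> c0 eta0.
have mS k : lebesgue_measurable (some_sparse c k).
  exact: lmeasurable_cellwise (@some_sparse_cellwise c k).
have [K SK] := tail_small mS (@some_sparse_homo c)
  (lmeasurable_box _ _) (lam_window_fin N) eta0.
apply: filterS (sparse_mass K N c0) => j jK.
apply: (@le_trans _ _ (lam (A j `&` (window N `&` some_sparse c K)) +
   lam (window N `&` ((\bigcup_k some_sparse c k) `\` some_sparse c K)))%E).
  apply: (le_trans _ (lebesgue_outerU _ _)); apply: le_lebesgue_outer.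
  move=> x [Ax [xN /contrapT xS]].
  by have [xK|xK] := pselect (some_sparse c K x); [left|right].
apply: leeD SK; apply: le_trans jK _; apply: lee_wpmul2l; first by rewrite lee_fin.
by apply: le_lebesgue_outer => x [].
Qed.

End UltrafilterCore.

(** * The property passes to the limit *)
Section LimitSet.
Context {R : realType} {n : nat}.
Implicit Types (x y : 'rV[R]_n.+1) (k l N : nat).
Local Notation lam := (@lebesgue_outer R n.+1).
Variables (P : set 'rV[R]_n.+1 -> bool) (I : set 'rV[R]_n.+1 -> \bar R).
Hypothesis satP : saturation_function P I.

Lemma property_mono A B : lebesgue_measurable A -> lebesgue_measurable B ->
  B `<=` A -> P A -> P B.
Proof. by move=> mA mB BA; have [_] := sat_monotone satP mA mB BA. Qed.

(** A positive maximal density provides some set with the property. *)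
Lemma property0 : P set0.
Proof.
have [[A [mA PA]]|noA] := pselect (exists A, lebesgue_measurable A /\ P A).
  exact: property_mono mA lmeasurable0 (@sub0set _ _) PA.
have := sat_density satP; rewrite /max_density (_ : image _ _ = set0).
  by rewrite ereal_sup0.
by apply/seteqP; split=> // v [A AP _]; apply: noA; exists A.
Qed.

Lemma finite_sub_window (S : set 'rV[R]_n.+1) : finite_set S ->
  exists N, S `<=` window N.
Proof.
move=> /finite_seqP [X ->].
pose b x := (\max_(i < n.+1) (Num.bound `|x 0%R i|))%N.
exists (\max_(x <- X) b x)%N => x xX i; rewrite !mxE.
have : `|x 0 i| < (\max_(y <- X) b y)%N%:R.
  apply: lt_le_trans (archi_boundP (normr_ge0 _)) _; rewrite ler_nat.
  apply: (@leq_trans (b x)); last exact: leq_bigmax_seq.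
  exact: (leq_bigmax_seq _ (mem_index_enum i)).
by rewrite ltr_norml => /andP[xl xr]; rewrite xl ltW.
Qed.

Lemma window_cube N : window N `<=` cube (0 : 'rV[R]_n.+1) (2 * N%:R + 1).
Proof.
move=> x xN i; have := xN i; rewrite !mxE subr0 ltr_norml => /andP[xl xr].
by apply/andP; split; lra.
Qed.

Variable FF : set (set 'rV[R]_n.+1).
Hypothesis FF_fin : forall S, FF S -> finite_set S.
Hypothesis FF_P : forall A, lebesgue_measurable A ->
  (P A <-> ~ exists2 S, FF S & S `<=` A).

Variables (A : nat -> set 'rV[R]_n.+1) (F : set_system nat).
Hypothesis mA : forall j, lebesgue_measurable (A j).
Hypothesis PA : forall j, P (A j).
Context {FU : UltraFilter F}.

Let FP : ProperFilter F. Proof. exact: ultra_proper. Qed.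
Let FFilter : Filter F. Proof. exact: filter_filter. Qed.

(** The cell of [x] lies in the cube of side [2 * 2^-k] around [x], which has at
most 3^d times its measure. *)
Lemma core_zooming_out (c : R) k N : 0 < c -> \forall j \near F,
  core A F c `&` window N `<=`
    zooming_out (2 / 2 ^+ k) (c / 3 ^+ n.+1) (A j `&` window N).
Proof.
move=> c0; have p3 : 0 < 3 ^+ n.+1 :> R by rewrite exprn_gt0.
have : \forall j \near F, forall x, window N x ->
    cell k x `<=` dense_cells A F c k ->
    (c%:E * lam (cell k x) < lam (A j `&` cell k x))%E.
  apply: (@near_cells R n F FU k N (fun j C => C `<=` dense_cells A F c k ->
    (c%:E * lam C < lam (A j `&` C))%E)) => x _.
  have [dx|nx] := pselect (dense_cells A F c k x).
    by apply: filterS dx => j.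
  by apply: filterE => j sub; case: nx; apply: sub.
apply: filterS => j dense x [cx xN].
have := dense x xN (cell_sub (@dense_cells_cellwise _ _ A F c k) (core_dense k cx)).
move=> cA; apply: (@le_lt_trans _ _ (c%:E * lam (cell k x))%E).
  apply: le_trans (lee_wpmul2l _ (lam_cube_le_cell k x x)) _.
    by rewrite lee_fin divr_ge0 // ltW.
  by rewrite muleA -EFinM divfK // lt0r_neq0.
apply: lt_le_trans cA _; apply: le_lebesgue_outer => y [Ay xy].
split; first exact: cell_cube xy.
by split=> //; exact: (cell_sub (@window_cellwise _ _ k N) xN xy).
Qed.

(** A finite forbidden subset of the limit set would lie in
Z_delta(1 - e)(Z_s(eps)(B)) for [B] the part of some [A j] in a window, with
[eps] and [delta] independent of the scale [s]; for small [s] the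
supersaturation and zooming conditions contradict the property of [B]. *)
Lemma core_points_property (e : R) (f : R -> R) scale :
  (forall delta : R, 0 < delta -> 0 < f delta) ->
  (forall (delta : R) B, 0 < delta -> lebesgue_measurable B ->
     ~~ P (zooming_out delta (1 - e) B) -> ((f delta)%:E <= I B)%E) ->
  P (density_points (fun m => core A F (2 ^+ m)^-1) e scale).
Proof.
move=> f0 fI; set G := fun m => core A F (2 ^+ m)^-1.
have mG m : lebesgue_measurable (G m) by exact: lmeasurable_core.
have G_homo m m' : (m <= m')%N -> G m `<=` G m'.
  move=> mm; apply: core_antimono; rewrite lef_pV2 ?posrE ?pow2_gt0 //.
  by rewrite ler_weXn2l // ler1n.
apply/(FF_P (lmeasurable_density_points e mG scale)) => -[S FFS SD].
have [m [i Smi]] := density_points_common G_homo (FF_fin FFS) SD.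
have [N0 SN0] := finite_sub_window (FF_fin FFS).
(* The extra unit makes the cubes of side [delta] around the points of [S] stay
   in the window. *)
pose N := N0.+1; pose delta : R := 2 / 2 ^+ scale i.
have delta0 : 0 < delta by rewrite divr_gt0 // pow2_gt0.
pose c : R := (2 ^+ m)^-1; have c0 : 0 < c by rewrite invr_gt0 pow2_gt0.
pose eps : R := c / 3 ^+ n.+1.
have eps0 : 0 < eps by rewrite divr_gt0 // exprn_gt0.
have [g [h [g0 h0 zoomI]]] := sat_zooming satP.
pose r : R := 2 * N%:R + 1; have r0 : 0 < r by rewrite /r; have := ler0n R N; lra.
have rd0 : 0 < r ^+ n.+1 by rewrite exprn_gt0.
have fd0 := f0 _ delta0; have ge0 := g0 _ eps0.
have [k hk] : exists k, h eps (2 / 2 ^+ k) * r ^+ n.+1 < g eps * f delta.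
  have : \forall s \near (0 : R)^'+, `|h eps s| < g eps * f delta / r ^+ n.+1.
    by have /cvgr0Pnorm_lt := h0 _ eps0; apply; rewrite divr_gt0 // mulr_gt0.
  move=> -[s /= s0 hs].
  have [k /(_ k (leqnn k)) ks] := pow2V_small (divr_gt0 s0 (ltr0n R 2)).
  have k0 : 0 < 2 / 2 ^+ k :> R by rewrite divr_gt0 // pow2_gt0.
  exists k; rewrite -ltr_pdivlMr //; apply: le_lt_trans (ler_norm _) _.
  apply: hs => //=; rewrite sub0r normrN gtr0_norm //; lra.
have [j Aj] := filter_ex (core_zooming_out k N c0).
pose B := A j `&` window N; pose Z := zooming_out (2 / 2 ^+ k) eps B.
have mB : lebesgue_measurable B by apply: lmeasurableI => //; exact: lmeasurable_box.
have s0 : 0 < 2 / 2 ^+ k :> R by rewrite divr_gt0 // pow2_gt0.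
have mZ : lebesgue_measurable Z by exact: lmeasurable_zooming_out.
have mZZ : lebesgue_measurable (zooming_out delta (1 - e) Z).
  exact: lmeasurable_zooming_out.
have nPZ : ~~ P (zooming_out delta (1 - e) Z).
  apply/negP => /(FF_P mZZ); apply; exists S => // x Sx.
  have [_ xZ] := Smi x Sx; apply: lt_le_trans xZ _.
  apply: le_lebesgue_outer => y [xy Gy]; split=> //; apply: Aj; split=> //.
  exact: cube_window (SN0 x Sx) _ xy.
have IZ := fI _ _ delta0 mZ nPZ.
have BN : B `<=` cube 0 r by move=> x [_ xN]; exact: window_cube.
have IB := zoomI _ _ _ _ eps0 s0 r0 mB BN.
have : ~~ P B.
  apply: (sat_positive satP mB); apply: lt_le_trans IB.
  apply: (@lt_le_trans _ _ ((g eps)%:E * (f delta)%:E -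
    (h eps (2 / 2 ^+ k) * r ^+ n.+1)%:E)%E).
    by rewrite -EFinM -EFinB lte_fin subr_gt0.
  by apply: leeB => //; apply: lee_wpmul2l => //; rewrite lee_fin ltW.
by rewrite (property_mono (mA j) mB) // => x [].
Qed.

End LimitSet.

(** * Local optimality of the limit *)
Section Optimality.
Context {R : realType} {n : nat}.
Implicit Types (x y : 'rV[R]_n.+1) (N : nat).
Local Notation lam := (@lebesgue_outer R n.+1).

Lemma coord_le_euclidean_dist x y i : `|x 0 i - y 0 i| <= euclidean_dist x y.
Proof.
rewrite -sqrtr_sqr /euclidean_dist ler_wsqrtr // (bigD1 i) //= lerDl.
by apply: sumr_ge0 => j _; exact: sqr_ge0.
Qed.

Lemma bounded_sub_window (S : set 'rV[R]_n.+1) : bounded_set S ->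
  exists N, S `<=` window N.
Proof.
move=> [M [_ SM]]; have {}SM := SM (M + 1) (ltr_pwDr ltr01 (lexx M)).
exists (Num.bound (M + 1)) => x /SM /= xM i; rewrite !mxE.
have M0 : 0 <= M + 1 by apply: le_trans xM.
have : `|x 0 i| < (Num.bound (M + 1))%:R.
  apply: le_lt_trans (archi_boundP M0); apply: le_trans xM.
  rewrite /Num.Def.normr /= mx_normrE.
  exact: (le_bigmax _ (fun ij : 'I_1 * 'I_n.+1 => `|x ij.1 ij.2|) (0, i)).
by rewrite ltr_norml => /andP[xl xr]; rewrite xl ltW.
Qed.

Lemma near_optimal (P : set 'rV[R]_n.+1 -> bool) (Omega : set 'rV[R]_n.+1) j : P set0 ->
  exists A, [/\ lebesgue_measurable A, A `<=` Omega `&` window j, P A &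
    forall B, lebesgue_measurable B -> B `<=` Omega `&` window j -> P B ->
      (lam B <= lam A + (j.+1%:R^-1)%:E)%E].
Proof.
move=> P0; pose C := [set A : set 'rV[R]_n.+1 |
  [/\ lebesgue_measurable A, A `<=` Omega `&` window j & P A]].
have C0 : C set0 by split=> //; exact: lmeasurable0.
have sup_fin : ereal_sup (lam @` C) \is a fin_num.
  rewrite ge0_fin_numE; last first.
    by apply: ereal_sup_ubound; exists set0 => //; rewrite lebesgue_outer0.
  apply: le_lt_trans (lam_window_fin j); apply: ge_ereal_sup => _ [A [_ AO _] <-].
  by apply: le_lebesgue_outer => x /AO[].
have j0 : 0 < j.+1%:R^-1 :> R by rewrite invr_gt0.
have [_ [A [mA AO PA] <-] lt_A] := ub_ereal_sup_adherent j0 sup_fin.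
exists A; split=> // B mB BO PB.
rewrite -leeBlDr //; apply: le_trans (ltW lt_A); apply: leeB => //.
by apply: ereal_sup_ubound; exists B.
Qed.

(** Cut and paste: an improvement [A'] of [A] on [S] is inserted into [B j],
after removing the little mass that [B j] has outside [A] near [S]. The removal
matters for the property: near [S], the new set is then contained in [A'], so
that a forbidden set meeting [S] would be contained in [A']. *)
Lemma locally_optimal_limit (P : set 'rV[R]_n.+1 -> bool) (Omega A : set 'rV[R]_n.+1)
    (B : nat -> set 'rV[R]_n.+1) (F : set_system nat) :
  boundedly_finite P -> ProperFilter F -> \oo `<=` F ->
  lebesgue_measurable A -> A `<=` Omega -> P A ->
  (forall j, [/\ lebesgue_measurable (B j), B j `<=` Omega `&` window j, P (B j) &
    forall C, lebesgue_measurable C -> C `<=` Omega `&` window j -> P C ->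
      (lam C <= lam (B j) + (j.+1%:R^-1)%:E)%E]) ->
  (forall N (eta : R), 0 < eta ->
    \forall j \near F, (lam (B j `&` (window N `\` A)) <= eta%:E)%E) ->
  locally_optimal P Omega A.
Proof.
move=> [FF [FF_fin FF_P [diam FF_diam]]] FP Foo mA AO PA BP mass.
split=> // S Sb mS [A' [mA' A'O PA' AA' lt_AA']].
have [N0 SN0] := bounded_sub_window Sb.
(* A forbidden set that meets [S] stays in the window [N]. *)
pose N := (N0 + Num.bound `|diam|)%N.
have mw : lebesgue_measurable (window N : set 'rV[R]_n.+1).
  exact: lmeasurable_box.
have SN x : S x -> window N x.
  by move=> /SN0; apply: window_homo; exact: leq_addr.
have near_S x y : S x -> euclidean_dist x y <= diam -> window N y.
  move=> Sx xy i; have := SN0 x Sx i; rewrite !mxE => /andP[xl xr].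
  have := archi_boundP (normr_ge0 diam); have := ler_norm diam.
  have := le_trans (coord_le_euclidean_dist x y i) xy.
  rewrite /N natrD ler_distl => /andP[yl yr] dl dr.
  by apply/andP; split; lra.
have offS x : ~ S x -> A x <-> A' x.
  move=> nSx; split=> [Ax|A'x].
    by have : (A `&` ~` S) x by []; rewrite AA' => -[].
  by have : (A' `&` ~` S) x by []; rewrite -AA' => -[].
have /lee_addgt0Pr : forall eta : R, 0 < eta ->
    (lam (A' `&` S) <= lam (A `&` S) + eta%:E)%E.
  move=> eta eta0; have e20 : 0 < eta / 2 by rewrite divr_gt0.
  have [K Keta] : exists K, forall j, (K <= j)%N -> j.+1%:R^-1 < eta / 2 :> R.
    have ev0 : 0 <= (eta / 2)^-1 by rewrite invr_ge0 ltW.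
    exists (Num.bound (eta / 2)^-1) => j Kj.
    rewrite -[ltRHS]invrK ltf_pV2 ?posrE ?invr_gt0 //.
    apply: lt_le_trans (archi_boundP ev0) _; rewrite ler_nat; exact: leqW.
  have : \forall j \near F, (maxn K N <= j)%N by apply: Foo; exists (maxn K N).
  move=> /(filterI (mass N _ e20)) /filter_ex [j [/= massj]].
  rewrite geq_max => /andP[/Keta etaj Nj].
  have [mB BO PB Bopt] := BP j.
  pose X := (B j `\` S) `\` (window N `\` A); pose C := (A' `&` S) `|` X.
  have mX : lebesgue_measurable X.
    by apply: lmeasurableD; exact: lmeasurableD.
  have mC : lebesgue_measurable C.
    by apply: lmeasurableU => //; exact: lmeasurableI.
  have CO : C `<=` Omega `&` window j.
    move=> x [[A'x Sx]|[[Bx _] _]]; last exact: BO.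
    by split; [exact: A'O|apply: window_homo Nj _ _; exact: SN].
  have PC : P C.
    apply/(FF_P _ mC) => -[T FFT TC].
    have [[x [Tx Sx]]|noS] := pselect (exists x, T x /\ S x).
      move/(FF_P _ mA'): PA'; apply; exists T => // y Ty.
      have yN := near_S x y Sx (FF_diam _ FFT _ _ Tx Ty).
      have [[//]|[[_ nSy] nwA]] := TC y Ty.
      by apply/(offS y nSy); apply: contrapT => nAy; apply: nwA.
    move/(FF_P _ mB): PB; apply; exists T => // y Ty.
    have [[_ Sy]|[[]//]] := TC y Ty.
    by case: noS; exists y.
  have lamC : (lam C = lam (A' `&` S) + lam X)%E.
    rewrite (mS C); congr (lam _ + lam _)%E; apply/seteqP; split=> x.
    - by move=> [[//|[[_ nS] _]] Sx].
    - by move=> [A'x Sx]; split=> //; left.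
    - by move=> [[[_ Sx]|//] nS].
    - by move=> Xx; split; [right|case: Xx => -[]].
  have lamB : (lam (B j) <= lam (A `&` S) + (lam (B j `&` (window N `\` A)) + lam X))%E.
    apply: (@le_trans _ _ (lam ((A `&` S) `|` ((B j `&` (window N `\` A)) `|` X)))).
      apply: le_lebesgue_outer => x Bx.
      have [wA|nwA] := pselect ((window N `\` A) x); first by right; left.
      have [Sx|nSx] := pselect (S x); last by right; right.
      by left; split=> //; apply: contrapT => nAx; apply: nwA; split=> //; exact: SN.
    apply: le_trans (lebesgue_outerU _ _) _; apply: leeD => //.
    exact: lebesgue_outerU.
  have := Bopt C mC CO PC; rewrite lamC.
  move: etaj; move: (j.+1%:R^-1) => u etaj opt.
  have finX : lam X \is a fin_num by apply: (@lam_bounded_fin _ _ _ j) => x [[/BO[]]].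
  have finS V : lam (V `&` S) \is a fin_num.
    by apply: (@lam_bounded_fin _ _ _ N) => x [_ /SN].
  have finB : lam (B j) \is a fin_num by apply: (@lam_bounded_fin _ _ _ j) => x /BO[].
  have finm : lam (B j `&` (window N `\` A)) \is a fin_num.
    by apply: (@lam_bounded_fin _ _ _ j) => x [/BO[]].
  move: opt lamB massj.
  rewrite -(fineK finX) -(fineK (finS A)) -(fineK (finS A')).
  rewrite -(fineK finB) -(fineK finm).
  by rewrite -!EFinD !lee_fin; lra.
by rewrite leNgt lt_AA'.
Qed.

End Optimality.

Theorem theorem11 (R : realType) (d : nat) (hd : (2 <= d)%N)
    (P : set 'rV[R]_d -> bool)
    (hfin : boundedly_finite P) (hsat : supersaturable P)
    (Omega : set 'rV[R]_d) (hOmega : lebesgue_measurable Omega) :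
  exists A : set 'rV[R]_d, locally_optimal P Omega A.
Proof.
case: d hd P hfin hsat Omega hOmega => // n _ P hfin [I hI] Omega mO.
have P0 := property0 hI.
have /choice [B BP] := fun j => near_optimal Omega j P0.
have mB j : lebesgue_measurable (B j) by have [] := BP j.
have PB j : P (B j) by have [] := BP j.
have [F [FU Foo]] := @ultraFilterLemma nat \oo _.
have FP : ProperFilter F by exact: ultra_proper.
have [e [f [e0 _ f0 fI]]] := sat_supersaturation hI.
pose G m := core B F (2 ^+ m)^-1.
have mG m : lebesgue_measurable (G m) by exact: lmeasurable_core.
have [scale full] := @exists_scales R n G e mG (fun m N eta => @density_small R n
  (some_sparse B F (2 ^+ m)^-1) N e eta (@some_sparse_cellwise _ _ B F _)
  (@some_sparse_homo _ _ B F _) e0).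
pose D := density_points G e scale.
have mD : lebesgue_measurable D by exact: lmeasurable_density_points.
have PD : P D.
  have [FF [FF_fin FF_P _]] := hfin.
  exact: (core_points_property hI FF_fin FF_P mB PB scale f0 fI).
(* [Omega] is imposed only now: intersecting with it preserves [P] by
   monotonicity, and loses no mass because the [B j] lie in [Omega]. *)
exists (D `&` Omega).
have mDO : lebesgue_measurable (D `&` Omega) by exact: lmeasurableI.
apply: (locally_optimal_limit hfin FP Foo mDO _ _ BP) => //.
  by apply: (property_mono hI mD mDO) PD => x [].
move=> N eta eta0.
have [m mE] : exists m, ((2 ^+ m)^-1%:E *
    lebesgue_outer (window N : set 'rV[R]_n.+1) <= (eta / 2)%:E)%E.
  have wfin : lebesgue_outer (window N : set 'rV[R]_n.+1) \is a fin_num.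
    exact: (@lam_bounded_fin _ _ _ N).
  rewrite -(fineK wfin).
  have := fine_ge0 (lebesgue_outer_ge0 (window N : set 'rV[R]_n.+1)).
  move: (fine _) => w w0; have w1 : 0 < w + 1 by lra.
  have [m /(_ m (leqnn m)) mw] := pow2V_small (divr_gt0 (divr_gt0 eta0 (ltr0n R 2)) w1).
  exists m; rewrite -EFinM lee_fin.
  move: mw; rewrite ltr_pdivlMr // => mw; nra.
have m0 : 0 <= (2 ^+ m)^-1 :> R by rewrite invr_ge0 ltW // pow2_gt0.
apply: filterS (core_mass mB N m0 (divr_gt0 eta0 (ltr0n R 2))) => j Bj.
have [_ BO _ _] := BP j.
apply: (@le_trans _ _ (lebesgue_outer (B j `&` (window N `\` G m)) +
  lebesgue_outer (window N `&` (G m `\` D)))%E).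
  apply: (le_trans _ (lebesgue_outerU _ _)); apply: le_lebesgue_outer.
  move=> x [Bx [xN nDO]]; have [Gx|nGx] := pselect (G m x); last by left.
  right; split=> //; split=> // Dx; apply: nDO; split=> //.
  by have [] := BO x Bx.
rewrite full adde0; apply: le_trans Bj _.
by apply: (le_trans (leeD mE (lexx _))); rewrite -EFinD -splitr.
Qed.
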